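(* Let $\varrho_0>0$ be a constant and let the initial data satisfy $\varrho_h^0=\varrho_0+\varepsilon^2\varrho_{h_2}^0$ (with $\varrho_{h_2}^0=\mathcal O(1)$) and $\mathbf u_h^0=\mathcal O(1)$. Then the numerical solution of the linear system $$\varrho_{h}^{n+1} = \Big(I - \Delta t^n h \lambda\Delta_h - \big(\tfrac{\Delta t^n}{\varepsilon}\big)^2 p'(\varrho_0)\, \mathrm{div}_h (I - \Delta t^n h \lambda\Delta_h)^{-1} \nabla_h \Big)^{-1}\Big(\varrho_{h}^n - \Delta t^n\, \mathrm{div}_h \big( (I - \Delta t^n h \lambda\Delta_h)^{-1} (\varrho_{h}^{n}\mathbf{u}_{h}^{n} - \Delta t^n \mathrm{div}_h(\varrho_h^{n} \mathbf{u}_h^{n} \otimes \mathbf{u}_h^{n}))\big)\Big),$$ $$\varrho_{h}^{n+1}\mathbf{u}_{h}^{n+1} = (I - \Delta t^n h \lambda\Delta_h)^{-1} \Big(\varrho_{h}^{n}\mathbf{u}_{h}^{n}- \Delta t^n \mathrm{div}_h(\varrho_h^{n} \mathbf{u}_h^{n} \otimes \mathbf{u}_h^{n}) - \frac{\Delta t^n}{\varepsilon^2} p'(\varrho_0)\nabla_h \varrho_h^{n+1} \Big),\qquad 0\le n\le N-1,$$ satisfies, for $1\le n\le N$, $\varrho_h^n=\varrho_0+\varepsilon^2\varrho_{h_2}^n$ with $\varrho_{h_2}^n=\mathcal O(1)$, $\mathbf u_h^n=\mathcal O(1)$, and $\mathrm{div}_h\mathbf u_h^n=\mathcal O(\varepsilon^2)$.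 Further, in the limit as $\varepsilon\to0$, the momentum update equation becomes $$\mathbf{u}_{h_0}^{n+1} = \mathbf{u}_{h_0}^{n}- \Delta t^n\, \mathrm{div}_h(\mathbf{u}_{h_0}^{n} \otimes \mathbf{u}_{h_0}^{n}) - \Delta t^n\frac{p'(\varrho_0)}{\varrho_0} \nabla_h \varrho_{h_2}^{n+1} + \Delta t^n h \lambda\Delta_h \mathbf{u}_{h_0}^{n+1},$$ where $\mathbf u_{h_0}^n$ is the leading-order term of $\mathbf u_h^n$ and $\nabla_h\varrho_{h_2}^{n+1}$ stands for its leading-order ($\varepsilon\to0$) value; this is a consistent numerical approximation of $$\partial_t\mathbf u_0+\mathrm{div}_x(\mathbf u_0\otimes\mathbf u_0)+\frac{\nabla_xp_2}{\varrho_0}=\mathbf 0,\qquad p_2=p'(\varrho_0)\varrho_2,$$ if the solution variables have enough regularity.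
   Context: Pressure: $p(\varrho)=\kappa\varrho^\gamma$, constants $\kappa>0,\gamma>1$. Mesh: $\Omega$ is a periodic $d$-dimensional box, $d\in\{1,2,3\}$, divided into a uniform structured mesh $\mathcal T_h$ of cubic cells of mesh size (side length) $h$. $\mathcal E(K)$ is the set of faces of $K$; every face $\sigma=K|L$ is shared by two cells; $\mathbf n_{\sigma,K}$ is the unit normal pointing out of $K$; $|K|,|\sigma|$ are the $d$- and $(d-1)$-dimensional measures; $d_\sigma=h$ is the distance between the centers of $K$ and $L$. $Q_h$ is the space of functions constant on each cell, $\boldsymbol Q_h=Q_h^d$; $\varrho_h^n\in Q_h$, $\mathbf u_h^n\in\boldsymbol Q_h$. With $\{\!\{\phi\}\!\}_\sigma=(\phi_K+\phi_L)/2$ and $[\![\phi]\!]_{\sigma,K}=\phi_L-\phi_K$: $(\nabla_h\phi_h)_K=\sum_{\sigma\in\mathcal E(K)}\frac{|\sigma|}{|K|}\{\!\{\phi_h\}\!\}_\sigma\mathbf n_{\sigma,K}$, $(\mathrm{div}_h\boldsymbol\varphi_h)_K=\sum_{\sigma\in\mathcal E(K)}\frac{|\sigma|}{|K|}\{\!\{\boldsymbol\varphi_h\}\!\}_\sigma\cdot\mathbf n_{\sigma,K}$, $(\Delta_h\phi_h)_K=\sum_{\sigma\in\mathcal E(K)}\frac{|\sigma|}{|K|}\frac{[\![\phi_h]\!]_{\sigma,K}}{d_\sigma}$, acting componentwise on vector (tensor) fields where appropriate. $I$ is the identity. The operators that are inverted are invertible. $0=t^0<\dots<t^N=T$, $\Delta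 t^n=t^{n+1}-t^n$; $\lambda\ge0$ is a constant numerical diffusion coefficient. Asymptotics: $\varepsilon\to0$ with mesh, time steps and $\lambda$ fixed independently of $\varepsilon$; $\mathcal O(\varepsilon^k)$ means bounded by a constant (depending on mesh, time steps, $\lambda$, data) times $\varepsilon^k$ for all small $\varepsilon>0$. For velocities, $\mathbf u_h^n=\mathcal O(1)$ is understood as $\mathbf u_h^n=\mathbf u_{h_0}^n+\mathcal O(\varepsilon)$ with $\mathbf u_{h_0}^n$ independent of $\varepsilon$. ''Consistent numerical approximation'' means: inserting (projections to the grid of) sufficiently smooth functions $\mathbf u_0$, $\varrho_2$ solving the limit equation into the discrete equation divided by $\Delta t^n$ leaves a residual tending to $0$ as $h,\Delta t^n\to0$. *)

(* Defs.v *)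
From HB Require Import structures.
From mathcomp Require Import all_boot all_order all_algebra.
From mathcomp Require Import all_classical all_reals all_analysis.

Set Implicit Arguments.
Unset Strict Implicit.
Unset Printing Implicit Defensive.

Import Order.TTheory GRing.Theory Num.Theory.
Import numFieldNormedType.Exports.

Local Open Scope classical_set_scope.
Local Open Scope ring_scope.

Definition pressure {R : realType} (kappa gamma : R) (r : R) : R :=
  kappa * r `^ gamma.

(* Cells are multi-indices K; cell K is the cube prod_i [K_i h, (K_i + 1) h]. *)
Definition cell (d : nat) (N : 'I_d -> nat) : finType :=
  {dffun forall i : 'I_d, 'I_(N i)}.

(* A grid function is constant on each cell, hence a finite function of the
   cell index.  Scalar values are taken in R^o, that is R seen as a module over
   itself. *)
Definition grid {R : realType} (d : nat) (N : 'I_d -> nat)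
  (V : vectType R) : vectType R := {ffun cell N -> V}.

Notation Qh R N := (grid N R^o).
Notation QhV R d N := (grid N 'rV[R]_d).
Notation QhT R d N := (grid N 'M[R]_d).

(* The face (i, true), resp. (i, false), of a cell is the one orthogonal to the
   i-th axis on the side of increasing, resp. decreasing, i-th coordinate. *)
Definition face (d : nat) : finType := ('I_d * bool)%type.

Definition normal {R : realType} (d : nat) (s : face d) : 'rV[R]_d :=
  if s.2 then delta_mx 0 s.1 else - delta_mx 0 s.1.

(* The cell sharing the face s with K; indices wrap around. *)
Definition neighbor (d : nat) (N : 'I_d -> nat) (K : cell N) (s : face d) :
    cell N :=
  [ffun j : 'I_d =>
     if j == s.1 then (if s.2 then ordS (K j) else ord_pred (K j)) else K j].

Section Operators.
Context {R : realType} {d : nat} {N : 'I_d -> nat}.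
Implicit Types (h dt lambda eps a : R) (V : vectType R) (K : cell N).

(* |sigma| / |K| *)
Definition face_ratio h : R := h ^+ d.-1 / h ^+ d.

Definition average V (phi : grid N V) K (s : face d) : V :=
  2^-1 *: (phi K + phi (neighbor K s)).

Definition jump V (phi : grid N V) K (s : face d) : V :=
  phi (neighbor K s) - phi K.

Definition grad_h h (phi : Qh R N) : QhV R d N :=
  [ffun K => \sum_(s : face d)
     (face_ratio h * average phi K s) *: normal s].

Definition div_h h (v : QhV R d N) : Qh R N :=
  [ffun K => \sum_(s : face d)
     face_ratio h * (average v K s *m (normal s)^T) 0 0].

Definition divT_h h (w : QhT R d N) : QhV R d N :=
  [ffun K => \row_j div_h h [ffun L => row j (w L)] K].

Definition lap_h h V (phi : grid N V) : grid N V :=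
  [ffun K => \sum_(s : face d) (face_ratio h / h) *: jump phi K s].

Definition cst_grid (r : R) : Qh R N := [ffun => r].

Definition smul (r : Qh R N) (v : QhV R d N) : QhV R d N :=
  [ffun K => r K *: v K].

Definition tensor (v w : QhV R d N) : QhT R d N :=
  [ffun K => (v K)^T *m w K].

(* I - dt h lambda Delta_h *)
Definition visc h dt lambda V (phi : grid N V) : grid N V :=
  phi - (dt * h * lambda) *: lap_h h phi.

End Operators.

(* linfun f agrees with f only for linear f, hence the linearity facts. *)
Section Linearity.
Context {R : realType} {d : nat} {N : 'I_d -> nat}.
Variables (h dt lambda : R).

Lemma average_linear (V : vectType R) (K : cell N) s :
  linear (fun phi : grid N V => average phi K s).
Proof.
move=> c u v; rewrite /average !ffunE.
rewrite addrACA -scalerDr [LHS]scalerDr; congr (_ + _).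
by rewrite !scalerA mulrC.
Qed.

Lemma grad_h_linear : linear (grad_h h : Qh R N -> QhV R d N).
Proof.
move=> c u v; apply/ffunP => K; rewrite !ffunE scaler_sumr -big_split /=.
apply: eq_bigr => s _; rewrite average_linear mulrDr scalerDl.
by rewrite -scalerAr [in RHS]scalerA.
Qed.
HB.instance Definition _ :=
  GRing.isLinear.Build R (Qh R N) (QhV R d N) _ (grad_h h) grad_h_linear.

Lemma div_h_linear : linear (div_h h : QhV R d N -> Qh R N).
Proof.
move=> c u v; apply/ffunP => K; rewrite !ffunE scaler_sumr -big_split /=.
apply: eq_bigr => s _; rewrite average_linear mulmxDl -scalemxAl !mxE mulrDr.
by rewrite [_ * (c * _)]mulrCA.
Qed.
HB.instance Definition _ :=
  GRing.isLinear.Build R (QhV R d N) (Qh R N) _ (div_h h) div_h_linear.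

Lemma lap_h_linear (V : vectType R) :
  linear (lap_h h (V := V) : grid N V -> grid N V).
Proof.
move=> c u v; apply/ffunP => K; rewrite !ffunE scaler_sumr -big_split /=.
apply: eq_bigr => s _; rewrite /jump !ffunE opprD addrACA -scalerBr scalerDr.
by rewrite !scalerA mulrC.
Qed.
HB.instance Definition _ (V : vectType R) :=
  GRing.isLinear.Build R (grid N V) (grid N V) _ (lap_h h (V := V))
    (lap_h_linear (V := V)).

Lemma visc_linear (V : vectType R) :
  linear (visc h dt lambda (V := V) : grid N V -> grid N V).
Proof.
move=> c u v; rewrite /visc linearP scalerDr opprD addrACA scalerBr.
by rewrite !scalerA mulrC.
Qed.
HB.instance Definition _ (V : vectType R) :=
  GRing.isLinear.Build R (grid N V) (grid N V) _ (visc h dt lambda (V := V))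
    (visc_linear (V := V)).

(* (I - dt h lambda Delta_h)^-1 *)
Definition visc_inv (V : vectType R) (phi : grid N V) : grid N V :=
  ((linfun (visc h dt lambda (V := V)))^-1)%VF phi.
HB.instance Definition _ (V : vectType R) :=
  GRing.Linear.copy (visc_inv (V := V))
    (fun_of_lfun ((linfun (visc h dt lambda (V := V)))^-1)%VF).

Variables (eps a : R).

(* I - dt h lambda Delta_h
     - (dt / eps)^2 a div_h (I - dt h lambda Delta_h)^-1 grad_h *)
Definition density_op (phi : Qh R N) : Qh R N :=
  visc h dt lambda phi
    - ((dt / eps) ^+ 2 * a) *: div_h h (visc_inv (grad_h h phi)).

Lemma density_op_linear : linear density_op.
Proof.
move=> c u v; rewrite /density_op !linearP /= !scalerDr.
by rewrite addrACA.
Qed.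
HB.instance Definition _ :=
  GRing.isLinear.Build R (Qh R N) (Qh R N) _ density_op density_op_linear.

Definition density_op_inv (phi : Qh R N) : Qh R N :=
  ((linfun density_op)^-1)%VF phi.

Definition explicit_momentum (r : Qh R N) (u : QhV R d N) : QhV R d N :=
  smul r u - dt *: divT_h h (tensor (smul r u) u).

(* One step (r, u) -> (r', u') of the linear scheme, with a = p'(rho_0). *)
Definition scheme_step (r : Qh R N) (u : QhV R d N)
    (r' : Qh R N) (u' : QhV R d N) : Prop :=
  r' = density_op_inv (r - dt *: div_h h (visc_inv (explicit_momentum r u)))
  /\
  smul r' u' = visc_inv (explicit_momentum r u
                         - (dt / eps ^+ 2 * a) *: grad_h h r').

(* Right-hand side of the limit momentum update, with g standing for
   grad_h rho_2. *)
Definition limit_update (rho0 : R) (u u' g : QhV R d N) : QhV R d N :=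
  u - dt *: divT_h h (tensor u u) - (dt * (a / rho0)) *: g
    + (dt * h * lambda) *: lap_h h u'.

End Linearity.

(* f_eps = O(eps^k) as eps -> 0+, the mesh being fixed. *)
Definition isO {R : realType} (d : nat) (N : 'I_d -> nat)
    (V : normedModType R) (k : nat) (f : R -> cell N -> V) : Prop :=
  forall K, (fun eps : R => f eps K) =O_ (0^'+) (fun eps => eps ^+ k).

Section Consistency.
Context {R : realType} {d : nat}.
Implicit Types (f p : R -> 'rV[R]_d -> R) (g : 'rV[R]_d -> R).

(* Mean value of g along the segment [x, x + h e_i]. *)
Definition line_mean (h : R) (i : 'I_d) g (x : 'rV[R]_d) : R :=
  h^-1 * \int[lebesgue_measure]_(s in `[0, h]) g (x + s *: delta_mx 0 i).

(* Projection onto Q_h: the mean value over each cell, 1 / |K| int_K g, written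
   as an iterated integral over the d coordinates. *)
Definition proj_h (N : 'I_d -> nat) (h : R) g : Qh R N :=
  [ffun K : cell N => foldr (line_mean h) g (enum 'I_d) (\row_i ((K i)%:R * h))].

Definition projV_h (N : 'I_d -> nat) (h : R) (v : 'rV[R]_d -> 'rV[R]_d) :
    QhV R d N :=
  [ffun K => \row_j proj_h N h (fun x => v x 0 j) K].

Definition periodic (V : Type) (ell : 'I_d -> R) (w : 'rV[R]_d -> V) : Prop :=
  forall i x, w (x + ell i *: delta_mx 0 i) = w x.

Definition slab (T : R) : set (R * 'rV[R]_d) :=
  [set z | z.1 \in `[0, T]].

(* f is of class C^1 on [0, T] x R^d: f is continuous there and has space
   derivatives there and a time derivative for 0 < t < T, all of which extend
   continuously to [0, T] x R^d. *)
Definition C1 (T : R) f : Prop :=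
  [/\ {within slab T, continuous (fun z => f z.1 z.2)},
      exists ft : R * 'rV[R]_d -> R,
        {within slab T, continuous ft} /\
        forall t x, t \in `]0, T[ -> is_derive t 1 (f^~ x) (ft (t, x)) &
      forall i : 'I_d, exists fi : R * 'rV[R]_d -> R,
        {within slab T, continuous fi} /\
        forall t x, t \in `[0, T] ->
          is_derive x (delta_mx 0 i) (f t) (fi (t, x))].

(* d_t u + div_x (u (x) u) + grad_x (a r) / rho0 = 0, componentwise. *)
Definition limit_equation (T a rho0 : R)
    (u : R -> 'rV[R]_d -> 'rV[R]_d) (r : R -> 'rV[R]_d -> R) : Prop :=
  forall t x, t \in `]0, T[ -> forall j : 'I_d,
    derive1 (fun s => u s x 0 j) t
    + \sum_(i < d) 'D_(delta_mx 0 i) (fun y => u t y 0 j * u t y 0 i) x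
    + 'D_(delta_mx 0 j) (fun y => a * r t y) x / rho0 = 0.

(* Residual of the limit momentum update, divided by dt, for the projections of
   u and r. *)
Definition limit_residual (N : 'I_d -> nat) (h dt lambda a rho0 t : R)
    (u : R -> 'rV[R]_d -> 'rV[R]_d) (r : R -> 'rV[R]_d -> R) : QhV R d N :=
  dt^-1 *: (projV_h N h (u (t + dt))
            - limit_update h dt lambda a rho0
                (projV_h N h (u t)) (projV_h N h (u (t + dt)))
                (grad_h h (proj_h N h (r (t + dt))))).

(* The meshes range over all the uniform cubic meshes of the periodic box with
   side lengths ell. *)
Definition consistent_limit_update (ell : 'I_d -> R) (T lambda a rho0 : R) :
    Prop :=
  forall (u : R -> 'rV[R]_d -> 'rV[R]_d) (r : R -> 'rV[R]_d -> R),
    (forall t, periodic ell (u t)) -> (forall t, periodic ell (r t)) ->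
    (forall j, C1 T (fun t x => u t x 0 j)) -> C1 T r ->
    limit_equation T a rho0 u r ->
    forall eta : R, 0 < eta -> exists2 delta : R, 0 < delta &
      forall (N : 'I_d -> nat) (h dt t : R),
        (forall i, 1 < N i)%N -> (forall i, (N i)%:R * h = ell i) ->
        0 < h < delta -> 0 < dt < delta -> 0 <= t -> t + dt <= T ->
        forall K, `|limit_residual N h dt lambda a rho0 t u r K| < eta.

End Consistency.

(* Main.v *)
Require Import Defs.
From HB Require Import structures.
From mathcomp Require Import all_boot all_order all_algebra.
From mathcomp Require Import all_classical all_reals all_analysis.
From mathcomp Require Import ring lra.
Import Order.TTheory GRing.Theory Num.Theory.
Import numFieldNormedType.Exports.
Local Open Scope classical_set_scope.
Local Open Scope ring_scope.

Set Implicit Arguments.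
Unset Strict Implicit.
Unset Printing Implicit Defensive.

(** Write A for the operator I - dt h lambda Delta_h, a for p'(rho_0), k for
    dt^2 a, and m for the explicit momentum rho u - dt div_h (rho u (x) u) of
    the old time level.

    Asymptotics.  Summation by parts on the periodic grid makes grad_h the
    negative adjoint of div_h and gives <A phi, phi> >= <phi, phi>, so that
    both implicit operators are injective, hence invertible.  As all the difference
    operators commute, applying A to the density update eliminates the inverse
    of A.  With rho = rho_0 + eps^2 rho_2 and rho' = rho_0 + eps^2 rho_2' the
    constants cancel and the update reads (lemma [step_perturbation])

      eps^2 A A rho_2' - k div_h grad_h rho_2' = eps^2 A rho_2 - dt div_h m.

    Since div_h and - grad_h are adjoint, div_h grad_h has the same range as
    div_h (lemma [helmholtz]); so there is a fixed x with
    k div_h grad_h x = dt div_h m_0, where m_0 is the limit of m.  Then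
    z = rho_2' - x solves the same equation with right-hand side
    eps^2 A (rho_2 - A x) - dt div_h (m - m_0), and testing it with z yields
    (lemma [density_energy])

      eps^2 |A z|^2 + k |grad_h z|^2
        <= eps^2 |rho_2 - A x|^2 + (dt^2 / k) |m - m_0|^2 = O(eps^2).

    This one inequality says both that rho_2' is O(1) and that grad_h rho_2'
    is grad_h x + O(eps).  No convergence of rho_2' itself is claimed: the
    component of rho_2' in the kernel of grad_h (constants, and checkerboard
    modes on even grids) is controlled only through the first term.  The
    momentum update then gives u' = u_0' + O(eps) and the limit equation for
    u_0'.  Finally the two updates combine into the discrete mass balance
    A rho' = rho - dt div_h (rho' u'), in which the constants cancel again, so
    that div_h (rho' u') and with it div_h u' is O(eps^2).  An induction over
    the time steps concludes (lemma [asymptotics]).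

    Consistency.  The mean value over a cell is linear and monotone on
    continuous functions and commutes with translations.  A difference quotient
    of the projection of f is therefore the mean of the difference quotients of
    f, that is, by the mean value theorem, a mean of values of a derivative of
    f near the cell.  Periodicity turns the wrap-around of the grid into a
    translation, so every point that a cell uses is close to the corner of that
    cell, and the corners lie in a fixed compact box.  By Heine-Cantor the
    velocity, the density perturbation and their space derivatives take there,
    up to a small e, their values at the corner, and so every term of the
    residual is close to the corresponding term of the differential equation,
    while the numerical diffusion, lambda times the difference of a forward and
    a backward quotient in each direction, is small.  The time derivative is
    taken only at times inside the open interval, where the equation expresses
    it by space derivatives (lemma [limit_update_consistent]). *)

(** * Grid operators as difference operators, and summation by parts *)

Section GridCalculus.
Context {R : realType} {d : nat} {N : 'I_d -> nat}.
Implicit Types (K : cell N) (phi psi : Qh R N) (v w : QhV R d N) (s : face d).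

Lemma gridDE phi psi K : (phi + psi) K = (phi K : R) + psi K.
Proof. by rewrite ffunE. Qed.
Lemma gridNE phi K : (- phi) K = - (phi K : R).
Proof. by rewrite ffunE. Qed.
Lemma gridZE c phi K : (c *: phi) K = c * (phi K : R).
Proof. by rewrite ffunE. Qed.
Lemma gridVDE v w K j : (v + w) K 0 j = v K 0 j + w K 0 j.
Proof. by rewrite ffunE mxE. Qed.
Lemma gridVNE v K j : (- v) K 0 j = - v K 0 j.
Proof. by rewrite ffunE mxE. Qed.
Lemma gridVZE c v K j : (c *: v) K 0 j = c * v K 0 j.
Proof. by rewrite ffunE mxE. Qed.
Lemma gridVsubE v w K j : (v - w) K 0 j = v K 0 j - w K 0 j.
Proof. by rewrite gridVDE gridVNE. Qed.
Lemma smulE phi v K j : smul phi v K 0 j = (phi K : R) * v K 0 j.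
Proof. by rewrite ffunE mxE. Qed.
Lemma cst_gridE (c : R) K : cst_grid c K = c.
Proof. by rewrite ffunE. Qed.
Definition gridE :=
  (gridDE, gridNE, gridZE, gridVDE, gridVNE, gridVZE, smulE, cst_gridE).

Definition opposite s : face d := (s.1, ~~ s.2).

Lemma neighborK s : cancel (fun K => neighbor K s) (fun K => neighbor K (opposite s)).
Proof.
move=> K; apply/ffunP => j; rewrite !ffunE /=.
by case: eqP => // _; case: s.2; rewrite /= ?ordSK ?ord_predK.
Qed.

Lemma oppositeK : involutive opposite.
Proof. by case=> i b; rewrite /opposite negbK. Qed.

Lemma neighborC K s s' : neighbor (neighbor K s) s' = neighbor (neighbor K s') s.
Proof.
apply/ffunP => j; rewrite !ffunE /=.
by case: eqP => // _; case: eqP => // _; case: s.2; case: s'.2;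
  rewrite ?ordSK ?ord_predK.
Qed.

(** The neighbor map across a given face permutes the cells of the periodic
    grid; this is what makes summation by parts free of boundary terms. *)
Lemma sum_neighbor (F : cell N -> R) s : \sum_K F (neighbor K s) = \sum_K F K.
Proof.
rewrite [RHS](reindex (fun K => neighbor K s)) //.
apply: onW_bij; exists (fun K => neighbor K (opposite s)); first exact: neighborK.
by move=> K; have := neighborK (opposite s) K; rewrite oppositeK.
Qed.

Lemma sum_neighborM (f g : cell N -> R) s :
  \sum_K f (neighbor K s) * g K = \sum_K f K * g (neighbor K (opposite s)).
Proof.
rewrite -[RHS](sum_neighbor _ s); apply: eq_bigr => K _.
by rewrite neighborK.
Qed.

Lemma sum_face (V : zmodType) (F : face d -> V) :
  \sum_(s : face d) F s = \sum_i (F (i, true) + F (i, false)).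
Proof.
transitivity (\sum_i \sum_b F (i, b)).
  by rewrite pair_bigA; apply: eq_bigr => -[].
by apply: eq_bigr => i _; rewrite big_bool.
Qed.

(** The contributions phi_K of opposite faces cancel, which leaves centered
    differences; the same holds for the divergence below. *)
Lemma grad_hE h phi K j : grad_h h phi K 0 j =
  @face_ratio R d h / 2 * (phi (neighbor K (j, true)) - phi (neighbor K (j, false))).
Proof.
rewrite ffunE sum_face summxE (bigD1 j) //= big1 ?addr0.
  rewrite !mxE /= !eqxx /average /=.
  by rewrite /GRing.scale/=; field.
move=> i ij; rewrite !mxE /= [j == i]eq_sym (negPf ij) /=; ring.
Qed.

Lemma mulmx_normal (x : 'rV[R]_d) s :
  (x *m (normal s)^T) 0 0 = if s.2 then x 0 s.1 else - x 0 s.1.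
Proof.
rewrite mxE (bigD1 s.1) //= big1 ?addr0.
  by rewrite /normal; case: s.2; rewrite !mxE !eqxx /= ?mulrN mulr1.
by move=> j ji; rewrite /normal; case: s.2; rewrite !mxE (negPf ji) andbF ?oppr0 mulr0.
Qed.

Lemma div_hE h v K : div_h h v K = @face_ratio R d h / 2 *
  \sum_j (v (neighbor K (j, true)) 0 j - v (neighbor K (j, false)) 0 j).
Proof.
rewrite ffunE sum_face mulr_sumr; apply: eq_bigr => i _.
by rewrite !mulmx_normal /= !mxE; field.
Qed.

Lemma lap_hE h phi K : lap_h h phi K =
  @face_ratio R d h / h * \sum_(s : face d) (phi (neighbor K s) - phi K).
Proof. by rewrite ffunE mulr_sumr. Qed.

Lemma viscE h dt lambda phi K : visc h dt lambda phi K =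
  (phi K : R) - dt * h * lambda * lap_h h phi K.
Proof. by rewrite /visc !ffunE. Qed.

Definition coord j v : Qh R N := [ffun K => v K 0 j].

Lemma coordE j v K : coord j v K = v K 0 j.
Proof. by rewrite ffunE. Qed.

Lemma coord_lap h j v : coord j (lap_h h v) = lap_h h (coord j v).
Proof.
apply/ffunP => K; rewrite lap_hE !ffunE summxE mulr_sumr.
by apply: eq_bigr => s _; rewrite !mxE !ffunE.
Qed.

Lemma coord_visc h dt lambda j v :
  coord j (visc h dt lambda v) = visc h dt lambda (coord j v).
Proof. by rewrite /visc -coord_lap; apply/ffunP => K; rewrite !ffunE !mxE. Qed.

Definition sdot phi psi : R := \sum_K (phi K : R) * (psi K : R).
Definition vdot v w : R := \sum_j sdot (coord j v) (coord j w).

Lemma sdotC phi psi : sdot phi psi = sdot psi phi.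
Proof. by apply: eq_bigr => K _; rewrite mulrC. Qed.
Lemma sdot_linear psi : linear (fun phi => sdot phi psi : R^o).
Proof.
move=> c f g; rewrite /sdot scaler_sumr -big_split; apply: eq_bigr => K _ /=.
by rewrite !ffunE mulrDl -scalerAl.
Qed.

Lemma sdotBl f g psi : sdot (f - g) psi = sdot f psi - sdot g psi.
Proof.
by rewrite addrC -scaleN1r sdot_linear scaleN1r addrC.
Qed.
Lemma sdotZl c f psi : sdot (c *: f) psi = c * sdot f psi.
Proof.
by rewrite -[c *: f]addr0 sdot_linear [X in _ + X]/sdot big1 ?addr0 // => K _;
  rewrite ffunE mul0r.
Qed.

Lemma sdot_ge0 phi : 0 <= sdot phi phi.
Proof. by apply: sumr_ge0 => K _; rewrite -expr2 sqr_ge0. Qed.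
Lemma vdot_ge0 v : 0 <= vdot v v.
Proof. by apply: sumr_ge0 => j _; apply: sdot_ge0. Qed.

Lemma sdot_coef phi K : phi K ^+ 2 <= sdot phi phi.
Proof.
rewrite /sdot (bigD1 K) //= -expr2 lerDl.
by apply: sumr_ge0 => L _; rewrite -expr2 sqr_ge0.
Qed.

Lemma sdot_eq0 phi : sdot phi phi <= 0 -> phi = 0.
Proof.
move=> h; apply/ffunP => K; rewrite ffunE; apply/eqP;
  rewrite -sqrf_eq0 eq_le sqr_ge0 andbT.
exact: le_trans (sdot_coef _ _) h.
Qed.

Lemma vdot_coef v K j : v K 0 j ^+ 2 <= vdot v v.
Proof.
rewrite /vdot (bigD1 j) //=; apply: le_trans (_ : _ <= sdot (coord j v) (coord j v)) _.
  by have := sdot_coef (coord j v) K; rewrite ffunE.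
by rewrite lerDl; apply: sumr_ge0 => i _; apply: sdot_ge0.
Qed.

Lemma vdot_eq0 v : vdot v v <= 0 -> v = 0.
Proof.
move=> h; apply/ffunP => K; apply/rowP => j; rewrite ffunE mxE; apply/eqP;
  rewrite -sqrf_eq0 eq_le sqr_ge0 andbT.
exact: le_trans (vdot_coef _ _ _) h.
Qed.

(** Cell by cell the two sides differ by the square (e phi_K - psi_K)^2 / e. *)
Lemma sdot_young e phi psi : 0 < e ->
  2 * sdot phi psi <= e * sdot phi phi + e^-1 * sdot psi psi.
Proof.
move=> e0; rewrite /sdot !mulr_sumr -big_split; apply: ler_sum => K _ /=.
rewrite -subr_ge0.
have -> : e * (phi K * phi K) + e^-1 * (psi K * psi K) - 2 * (phi K * psi K)
   = e^-1 * (e * phi K - psi K) ^+ 2.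
  by field; rewrite gt_eqF.
by rewrite mulr_ge0 ?sqr_ge0 // invr_ge0 ltW.
Qed.

Lemma vdot_young e v w : 0 < e ->
  2 * vdot v w <= e * vdot v v + e^-1 * vdot w w.
Proof.
by move=> e0; rewrite /vdot !mulr_sumr -big_split; apply: ler_sum => j _ /=;
  apply: sdot_young.
Qed.

Lemma div_grad_adjoint h v psi : sdot (div_h h v) psi = - vdot v (grad_h h psi).
Proof.
have E K : (div_h h v K : R) * psi K = \sum_j @face_ratio R d h / 2 *
    ((v (neighbor K (j, true)) 0 j - v (neighbor K (j, false)) 0 j) * (psi K : R)).
  by rewrite div_hE -mulrA mulr_suml mulr_sumr.
rewrite /sdot (eq_bigr _ (fun K _ => E K)) exchange_big -sumrN;
  apply: eq_bigr => j _ /=.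
rewrite -mulr_sumr; under eq_bigr do rewrite mulrBl.
rewrite sumrB (sum_neighborM (fun K => v K 0 j) _ (j, true)).
rewrite (sum_neighborM (fun K => v K 0 j) _ (j, false)) /opposite /= -sumrB mulr_sumr
  -sumrN.
by apply: eq_bigr => K _; rewrite !coordE grad_hE; ring.
Qed.

(** Splitting off the cell values leaves only shifted sums, to which
    reindexing by neighbors applies. *)
Lemma sdot_lapE h phi psi : sdot (lap_h h phi) psi = @face_ratio R d h / h *
  \sum_s (\sum_K (phi (neighbor K s) : R) * (psi K : R) - sdot phi psi).
Proof.
have E K : (lap_h h phi K : R) * psi K = \sum_(s : face d) @face_ratio R d h / h *
    ((phi (neighbor K s) : R) * (psi K : R) - (phi K : R) * (psi K : R)).
  rewrite lap_hE -mulrA mulr_suml mulr_sumr.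
  by apply: eq_bigr => s _; rewrite mulrBl.
rewrite {1}/sdot (eq_bigr _ (fun K _ => E K)) exchange_big /= mulr_sumr.
by apply: eq_bigr => s _; rewrite -mulr_sumr sumrB.
Qed.

Lemma lap_h_sym h phi psi : sdot (lap_h h phi) psi = sdot phi (lap_h h psi).
Proof.
rewrite [RHS]sdotC !sdot_lapE; congr (_ * _); rewrite !sum_face.
apply: eq_bigr => i _; rewrite !(sum_neighborM phi) /opposite /= [sdot psi phi]sdotC.
rewrite addrC; congr (_ - _ + (_ - _)); by apply: eq_bigr => K _; rewrite mulrC.
Qed.

(** Cauchy-Schwarz: a grid function and its shift have the same norm. *)
Lemma lap_h_nonpos h phi : 0 <= @face_ratio R d h / h -> sdot (lap_h h phi) phi <= 0.
Proof.
move=> c0; rewrite sdot_lapE mulr_ge0_le0 //; apply: sumr_le0 => s _.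
rewrite subr_le0.
have E : \sum_K (phi (neighbor K s) : R) ^+ 2 = sdot phi phi.
  by rewrite (sum_neighbor (fun K => (phi K : R) ^+ 2)).
suff : \sum_K (phi (neighbor K s) : R) * (phi K : R) <=
    \sum_K 2^-1 * ((phi (neighbor K s) : R) ^+ 2 + (phi K : R) ^+ 2).
  move/le_trans; apply; rewrite -mulr_sumr big_split /= E.
  have -> : \sum_K (phi K : R) ^+ 2 = sdot phi phi by [].
  by lra.
apply: ler_sum => K _; have := sqr_ge0 ((phi (neighbor K s) : R) - phi K); nra.
Qed.

End GridCalculus.

(** * Invertibility of the implicit operators and the energy estimate *)

Section Elliptic.
Context {R : realType} {d : nat} {N : 'I_d -> nat}.
Implicit Types (K : cell N) (phi psi r : Qh R N) (v w u : QhV R d N).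
Variables (h dt lambda : R).
Hypotheses (h_gt0 : 0 < h) (dt_gt0 : 0 < dt) (lambda_ge0 : 0 <= lambda).

Local Notation A := (visc h dt lambda).

Lemma viscD V (phi psi : grid N V) : A (phi + psi) = A phi + A psi.
Proof. exact: linearD. Qed.
Lemma viscB V (phi psi : grid N V) : A (phi - psi) = A phi - A psi.
Proof. exact: linearB. Qed.
Lemma viscZ V c (phi : grid N V) : A (c *: phi) = c *: A phi.
Proof. exact: linearZ. Qed.
Lemma divB v w : div_h h (v - w) = div_h h v - div_h h w.
Proof. exact: linearB. Qed.
Lemma divD v w : div_h h (v + w) = div_h h v + div_h h w.
Proof. exact: linearD. Qed.
Lemma divZ c v : div_h h (c *: v) = c *: div_h h v.
Proof. exact: linearZ. Qed.
Lemma gradB phi psi : grad_h h (phi - psi) = grad_h h phi - grad_h h psi.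
Proof. exact: linearB. Qed.
Lemma gradD phi psi : grad_h h (phi + psi) = grad_h h phi + grad_h h psi.
Proof. exact: linearD. Qed.
Lemma gradZ c phi : grad_h h (c *: phi) = c *: grad_h h phi.
Proof. exact: linearZ. Qed.

Lemma visc_sym phi psi : sdot (A phi) psi = sdot phi (A psi).
Proof.
by rewrite /visc [RHS]sdotC !sdotBl !sdotZl lap_h_sym [sdot psi phi]sdotC [sdot (lap_h
  _ _) _]sdotC.
Qed.

Lemma visc_coercive phi : sdot phi phi <= sdot (A phi) phi.
Proof.
rewrite /visc sdotBl sdotZl lerDl oppr_ge0 mulr_ge0_le0 //.
  by rewrite !mulr_ge0 // ltW.
by apply: lap_h_nonpos; rewrite !divr_ge0 ?exprn_ge0 // ltW.
Qed.

(** A is at least the identity, so |phi|^2 <= <A phi, phi> <= |A phi| |phi|. *)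
Lemma visc_expand phi : sdot phi phi <= sdot (A phi) (A phi).
Proof.
have := visc_coercive phi; have := @sdot_young _ _ _ 1 (A phi) phi ltr01.
by rewrite invr1; lra.
Qed.

Lemma viscV_expand v : vdot v v <= vdot (A v) (A v).
Proof. by apply: ler_sum => j _; rewrite coord_visc visc_expand. Qed.

Lemma visc_invK v : A (visc_inv h dt lambda v) = v.
Proof.
rewrite /visc_inv -[A _]lfunE /= lker0_lfunVK //.
apply/lker0P => x y; rewrite !lfunE /= => Axy; apply/eqP; rewrite -subr_eq0; apply/eqP.
apply: vdot_eq0; apply: le_trans (viscV_expand _) _.
by rewrite viscB Axy subrr /vdot big1 // => j _; rewrite /sdot big1 // => K _;
  rewrite coordE !ffunE mxE mul0r.
Qed.

Lemma lap_cst c : lap_h h (cst_grid (N := N) c) = 0.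
Proof.
apply/ffunP => K; rewrite lap_hE [RHS]ffunE big1 ?mulr0 // => s _.
by rewrite !ffunE subrr.
Qed.

Lemma visc_cst c : A (cst_grid (N := N) c) = cst_grid c.
Proof. by rewrite /visc lap_cst scaler0 subr0. Qed.

Lemma grad_cst c : grad_h h (cst_grid (N := N) c) = 0.
Proof.
by apply/ffunP => K; apply/rowP => j; rewrite grad_hE [in RHS]ffunE !mxE !ffunE subrr
  mulr0.
Qed.

(** Both are combinations of translations, and these commute. *)
Lemma div_lap v : div_h h (lap_h h v) = lap_h h (div_h h v).
Proof.
apply/ffunP => K; rewrite div_hE lap_hE.
under [in RHS]eq_bigr do rewrite !div_hE -mulrBr -sumrB.
rewrite -mulr_sumr mulrCA exchange_big /=; congr (_ * _).
rewrite mulr_sumr; apply: eq_bigr => j _.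
rewrite -!coordE !coord_lap !lap_hE -mulrBr -sumrB; congr (_ * _).
apply: eq_bigr => s _; rewrite !coordE !(neighborC K s); ring.
Qed.

Lemma div_visc v : div_h h (A v) = A (div_h h v).
Proof. by rewrite /visc linearB linearZ /= div_lap. Qed.

(** By adjointness div_h is injective on the range of grad_h, and grad_h is
    injective on the range of div_h.  Hence div_h grad_h has at least the rank
    of div_h, and its range, contained in that of div_h, is all of it. *)
Lemma helmholtz v : exists phi, div_h h (grad_h h phi) = div_h h v.
Proof.
pose G := linfun (grad_h h : Qh R N -> _); pose D := linfun (div_h h : QhV R d N -> _).
have GD : (limg D :&: lker G = 0)%VS.
  apply/eqP; rewrite -subv0; apply/subvP => x; rewrite memv_cap memv_ker =>
    /andP[/memv_imgP[y _]].
  rewrite !lfunE /= => -> /eqP E; rewrite memv0; apply/eqP/sdot_eq0.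
  by rewrite div_grad_adjoint E /vdot big1 ?oppr0 // => j _;
    rewrite sdotC /sdot big1 // => K _; rewrite coordE !ffunE mxE mul0r.
have DG : (limg G :&: lker D = 0)%VS.
  apply/eqP; rewrite -subv0; apply/subvP => x; rewrite memv_cap memv_ker =>
    /andP[/memv_imgP[y _]].
  rewrite !lfunE /= => -> /eqP E; rewrite memv0; apply/eqP/vdot_eq0.
  by rewrite -oppr_ge0 -div_grad_adjoint E /sdot big1 // => K _; rewrite !ffunE mul0r.
have sub : (D @: limg G <= limg D)%VS by apply: limgS; exact: subvf.
have : (D @: limg G == limg D)%VS.
  rewrite eqEdim sub /= (limg_dim_eq DG) -(limg_dim_eq GD).
  by apply: dimvS; apply: limgS; exact: subvf.
move/eqP => E.
have : D v \in limg D by apply: memv_img; exact: memvf.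
rewrite -E => /memv_imgP[w /memv_imgP[phi _ ->]].
by rewrite !lfunE /= => ->; exists phi.
Qed.

(** Test the equation with phi, integrate by parts, and absorb half of each
    product on the right by Young's inequality. *)
Lemma density_energy (k eps : R) phi psi v : 0 < eps -> 0 < k ->
  eps ^+ 2 *: A (A phi) - k *: div_h h (grad_h h phi)
    = eps ^+ 2 *: A psi - dt *: div_h h v ->
  eps ^+ 2 * sdot (A phi) (A phi) + k * vdot (grad_h h phi) (grad_h h phi)
    <= eps ^+ 2 * sdot psi psi + dt ^+ 2 / k * vdot v v.
Proof.
move=> e0 k0 /(congr1 (sdot^~ phi)) E.
rewrite !sdotBl !sdotZl !div_grad_adjoint (visc_sym (A phi)) (visc_sym psi) in E.
have := @sdot_young _ _ _ 1 psi (A phi) ltr01.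
have kd : 0 < dt / k by rewrite divr_gt0.
have := vdot_young v (grad_h h phi) kd.
rewrite invr1 invf_div => Y1 Y2.
have e2 : 0 < eps ^+ 2 by rewrite exprn_gt0.
have Y3 := ler_wpM2l (ltW e2) Y2.
have Y4 := ler_wpM2l (ltW dt_gt0) Y1.
have T1 : dt * (dt / k * vdot v v) = dt ^+ 2 / k * vdot v v by field; rewrite gt_eqF.
have T2 : dt * (k / dt * vdot (grad_h h phi) (grad_h h phi)) =
  k * vdot (grad_h h phi) (grad_h h phi).
  by field; rewrite gt_eqF.
rewrite mulrDr T1 T2 in Y4.
lra.
Qed.

Variables (eps a : R).
Hypothesis (a_ge0 : 0 <= a).

(** A commutes with div_h, so it cancels the inner inverse: the operator
    becomes polynomial in the difference operators. *)
Lemma visc_density_op phi : A (density_op h dt lambda eps a phi) =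
  A (A phi) - ((dt / eps) ^+ 2 * a) *: div_h h (grad_h h phi).
Proof. by rewrite /density_op viscB viscZ -div_visc visc_invK. Qed.

Lemma density_op_invK phi :
  density_op h dt lambda eps a (density_op_inv h dt lambda eps a phi) = phi.
Proof.
rewrite /density_op_inv -[density_op _ _ _ _ _ _]lfunE /= lker0_lfunVK //.
apply/lker0P => x y; rewrite !lfunE /= => Exy; apply/eqP; rewrite -subr_eq0; apply/eqP.
have : density_op h dt lambda eps a (x - y) = 0 by rewrite linearB /= Exy subrr.
move/(congr1 (fun f => sdot (A f) (x - y))).
rewrite visc_density_op sdotBl sdotZl div_grad_adjoint (visc_sym (A _)).
have -> : A (0 : Qh R N) = 0 by exact: linear0.
rewrite [RHS]/sdot big1 => [|K _]; last by rewrite ffunE mul0r.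
move=> E; apply: sdot_eq0; apply: le_trans (visc_expand _) _.
have : 0 <= (dt / eps) ^+ 2 * a * vdot (grad_h h (x - y)) (grad_h h (x - y)).
  by rewrite mulr_ge0 ?vdot_ge0 // mulr_ge0 // sqr_ge0.
move: E; lra.
Qed.

Section Step.
Variables (r r' : Qh R N) (u u' : QhV R d N).
Hypothesis step : scheme_step h dt lambda eps a r u r' u'.

Lemma step_momentum : A (smul r' u') =
  explicit_momentum h dt r u - (dt / eps ^+ 2 * a) *: grad_h h r'.
Proof. by case: step => _ ->; rewrite visc_invK. Qed.

Lemma step_density : A (A r') - ((dt / eps) ^+ 2 * a) *: div_h h (grad_h h r') =
  A r - dt *: div_h h (explicit_momentum h dt r u).
Proof.
case: step => -> _; rewrite -visc_density_op density_op_invK viscB viscZ.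
by rewrite -div_visc visc_invK.
Qed.

(** Inserting the momentum update into the density update removes the
    pressure: what remains is the balance of mass. *)
Lemma step_mass : A r' = r - dt *: div_h h (smul r' u').
Proof.
have [E ->] := step; move/(congr1 (density_op h dt lambda eps a)): E.
rewrite density_op_invK /density_op => /(canRL (subrK _)) ->.
have -> : visc_inv h dt lambda (explicit_momentum h dt r u
    - (dt / eps ^+ 2 * a) *: grad_h h r') = visc_inv h dt lambda (explicit_momentum h
      dt r u)
    - (dt / eps ^+ 2 * a) *: visc_inv h dt lambda (grad_h h r').
  by rewrite linearB linearZ.
rewrite divB divZ scalerBr scalerA opprB addrA addrAC; congr (_ + _ *: _).
by rewrite expr_div_n expr2 !mulrA.
Qed.
End Step.

End Elliptic.

(** * Quantities of order eps^k *)

Section Order.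
Context {R : realType}.
Implicit Types (k l : nat) (p q : R -> R).

(** A real-valued counterpart of [isO] with an explicit constant; bounds on grid
    functions are reduced to it entry by entry. *)
Definition epsO k q := exists2 C : R, 0 <= C &
  \forall e \near 0^'+, `|q e| <= C * e ^+ k.

Lemma epsO_le k p q : (\forall e \near 0^'+, `|p e| <= `|q e|) -> epsO k q -> epsO k p.
Proof.
move=> pq [C C0 Cq]; exists C => //.
by apply: filterS2 pq Cq => e; exact: le_trans.
Qed.

Lemma epsO_eq k p q : (\forall e \near 0^'+, p e = q e) -> epsO k q -> epsO k p.
Proof. by move=> pq; apply: epsO_le; apply: filterS pq => e ->. Qed.

Lemma epsO_ext k p q : p =1 q -> epsO k q -> epsO k p.
Proof. by move=> pq; apply: epsO_eq; apply: nearW => e; rewrite pq. Qed.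

Lemma epsO0 k : epsO k (fun=> 0).
Proof. by exists 0 => //; apply: nearW => e; rewrite normr0 mul0r. Qed.

Lemma epsO_cst c : epsO 0 (fun=> c).
Proof. by exists `|c| => //; apply: nearW => e; rewrite mulr1. Qed.

Lemma right_gt0 : \forall e \near (0 : R)^'+, 0 < e.
Proof. exact: nbhs_right_gt. Qed.

Lemma epsO_eps k : epsO k (fun e => e ^+ k).
Proof.
exists 1 => //; apply: filterS right_gt0 => e e0.
by rewrite mul1r ger0_norm // exprn_ge0 // ltW.
Qed.

Lemma epsON k q : epsO k q -> epsO k (fun e => - q e).
Proof. by apply: epsO_le; apply: nearW => e; rewrite normrN. Qed.

Lemma epsOD k p q : epsO k p -> epsO k q -> epsO k (fun e => p e + q e).
Proof.
move=> [C C0 Cp] [D D0 Dq]; exists (C + D); first exact: addr_ge0.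
apply: filterS2 Cp Dq => e Cp Dq; rewrite mulrDl.
by apply: le_trans (ler_normD _ _) _; exact: lerD.
Qed.

Lemma epsOB k p q : epsO k p -> epsO k q -> epsO k (fun e => p e - q e).
Proof. by move=> bp bq; apply: epsOD => //; exact: epsON. Qed.

Lemma epsOM k l p q : epsO k p -> epsO l q -> epsO (k + l) (fun e => p e * q e).
Proof.
move=> [C C0 Cp] [D D0 Dq]; exists (C * D); first exact: mulr_ge0.
apply: filterS2 Cp Dq => e Cp Dq; rewrite normrM exprD mulrACA.
exact: ler_pM.
Qed.

Lemma epsOZ k c q : epsO k q -> epsO k (fun e => c * q e).
Proof. by move=> bq; have := epsOM (epsO_cst c) bq. Qed.


Lemma epsO_sum k (I : finType) (F : I -> R -> R) :
  (forall i, epsO k (F i)) -> epsO k (fun e => \sum_i F i e).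
Proof.
move=> bF; elim: (index_enum I) => [|i s IHs].
  by apply: epsO_ext (epsO0 k) => e; rewrite big_nil.
by apply: epsO_ext (epsOD (bF i) IHs) => e; rewrite big_cons.
Qed.

Lemma epsO_weak k l q : (k <= l)%N -> epsO l q -> epsO k q.
Proof.
move=> kl [C C0 Cq]; exists C => //; near=> e.
have Ce : `|q e| <= C * e ^+ l by near: e; exact: Cq.
apply: le_trans Ce _; apply: ler_wpM2l => //; apply: ler_wiXn2l => //.
by near: e; exact: nbhs_right_le.
Unshelve. all: end_near. Qed.

(** Energy estimates bound squares; this extracts the square root. *)
Lemma epsO_sqr k q : epsO k.*2 (fun e => q e ^+ 2) -> epsO k q.
Proof.
move=> [C C0 Cq]; exists (C + 1); first by rewrite addr_ge0.
near=> e; have Ce : `|q e ^+ 2| <= C * e ^+ k.*2 by near: e; exact: Cq.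
have e0 : 0 <= e by [].
rewrite -ler_sqr ?nnegrE ?mulr_ge0 ?exprn_ge0 ?addr_ge0 //.
rewrite -normrX; apply: le_trans Ce _; rewrite exprMn -exprM muln2.
by apply: ler_wpM2r; [rewrite exprn_ge0|nra].
Unshelve. all: end_near. Qed.

Lemma epsO_cvg q c : epsO 1 (fun e => q e - c) -> q e @[e --> 0^'+] --> c.
Proof.
move=> [C C0 Cq]; apply/cvgrPdist_le => eta eta0; near=> e.
have Ce : `|q e - c| <= C * e ^+ 1 by near: e; exact: Cq.
rewrite distrC; apply: le_trans Ce _; rewrite expr1.
have e0 : 0 < e by [].
have : e <= eta / (C + 1).
  by near: e; apply: nbhs_right_le; rewrite divr_gt0 // ltr_wpDl.
rewrite ler_pdivlMr ?ltr_wpDl // => h; nra.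
Unshelve. all: end_near. Qed.

Lemma epsO_near_gt q c : 0 < c -> epsO 1 (fun e => q e - c) ->
  \forall e \near 0^'+, c / 2 < q e.
Proof.
move=> c0 /epsO_cvg /cvgrPdist_lt /(_ (c / 2)).
have c2 : 0 < c / 2 by rewrite divr_gt0.
move=> /(_ c2); apply: filterS => e; rewrite ltr_norml; lra.
Qed.

(** A quantity converging to c > 0 eventually exceeds c / 2. *)
Lemma epsO_inv q c : 0 < c -> epsO 1 (fun e => q e - c) -> epsO 0 (fun e => (q e)^-1).
Proof.
move=> c0 /(epsO_near_gt c0) q0; exists (c / 2)^-1;
  first by rewrite invr_ge0 divr_ge0 // ltW.
apply: filterS q0 => e cq.
have c2 : 0 < c / 2 by rewrite divr_gt0.
have q0 := lt_trans c2 cq.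
by rewrite expr0 mulr1 gtr0_norm ?invr_gt0 // lef_pV2 // ltW.
Qed.

End Order.

Section GridOrder.
Context {R : realType} {d : nat} {N : 'I_d -> nat}.
Implicit Types (k l : nat).

Lemma rV_norm_le (n : nat) (x : 'rV[R]_n) (c : R) : 0 <= c ->
  (`|x| <= c) <-> (forall j, `|x 0 j| <= c).
Proof.
move=> c0; rewrite [`|x|]mx_normrE; split => [/bigmax_leP[_ H] j | H].
  exact: (H (0, j)).
by apply/bigmax_leP; split=> // -[i j] _ /=; rewrite ord1.
Qed.

Lemma rV_norm_coef (n : nat) (x : 'rV[R]_n) j : `|x 0 j| <= `|x|.
Proof. exact: (proj1 (@rV_norm_le n x _ (normr_ge0 _)) (lexx _) j). Qed.

Lemma isO_epsO k (f : R -> Qh R N) : isO k f <-> forall K, epsO k (fun e => f e K : R).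
Proof.
split=> H K.
  have /eqO_exP[C C0 CP] := H K; exists C; first exact: ltW.
  near=> e; have := near CP e => /(_ _) H1.
  apply: le_trans (H1 _) _ => //; rewrite [X in _ * X]ger0_norm // exprn_ge0 //.
apply/eqO_exP; have [C C0 CP] := H K; exists (C + 1); first by rewrite /= ltr_wpDl.
near=> e; apply: le_trans (_ : `|f e K| <= C * e ^+ k) _; first by near: e.
have ek : 0 <= e ^+ k by exact: exprn_ge0.
by rewrite [in leRHS]ger0_norm //; apply: ler_wpM2r => //; rewrite lerDl.
Unshelve. all: end_near. Qed.

Lemma isO_epsOV k (f : R -> QhV R d N) : isO k f <-> forall K j, epsO k (fun e =>
  f e K 0 j).
Proof.
split=> H K.
  move=> j; have /eqO_exP[C C0 CP] := H K; exists C; first exact: ltW.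
  near=> e; have := near CP e => /(_ _) H1.
  apply: le_trans (rV_norm_coef _ _) _.
  apply: le_trans (H1 _) _ => //; rewrite [X in _ * X]ger0_norm // exprn_ge0 //.
apply/eqO_exP.
have ex j : exists c, 0 <= c /\ \forall e \near 0^'+, `|f e K 0 j| <= c * e ^+ k.
  by have [C C0 CP] := H K j; exists C.
have [g gP] := choice ex.
have g0 : 0 <= \sum_j g j by apply: sumr_ge0 => j _; have [] := gP j.
(* A common constant for all entries of the vector. *)
exists (\sum_j g j + 1); first by rewrite /= ltr_wpDl.
have : \forall e \near 0^'+, forall j, `|f e K 0 j| <= g j * e ^+ k.
  by apply: filter_forall => j; have [] := gP j.
move=> gnear; near=> e.
have ek : 0 <= e ^+ k by exact: exprn_ge0.
rewrite [X in _ * X]ger0_norm //.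
apply/rV_norm_le; first by rewrite mulr_ge0 // addr_ge0.
move=> j; apply: le_trans (_ : g j * e ^+ k <= _); first by move: j; near: e;
  exact: gnear.
apply: ler_wpM2r => //; rewrite (bigD1 j) //= -addrA lerDl addr_ge0 //.
by apply: sumr_ge0 => i _; have [] := gP i.
Unshelve. all: end_near. Qed.

Lemma epsO_sdot k (f : R -> Qh R N) :
  (forall K, epsO k (fun e => f e K : R)) <-> epsO k.*2 (fun e => sdot (f e) (f e)).
Proof.
split=> H.
  by rewrite /sdot; apply: epsO_sum => K; rewrite -addnn; apply: epsOM.
move=> K; apply: epsO_sqr; apply: epsO_le H; apply: nearW => e.
by rewrite !ger0_norm ?sqr_ge0 ?sdot_ge0 // sdot_coef.
Qed.

Lemma epsO_vdot k (f : R -> QhV R d N) :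
  (forall K j, epsO k (fun e => f e K 0 j)) <-> epsO k.*2 (fun e => vdot (f e) (f e)).
Proof.
split=> H.
  apply: epsO_sum => j; apply/epsO_sdot => K.
  by apply: epsO_ext (H K j) => e; rewrite coordE.
move=> K j; apply: epsO_sqr; apply: epsO_le H; apply: nearW => e.
by rewrite !ger0_norm ?sqr_ge0 ?vdot_ge0 // vdot_coef.
Qed.

Lemma epsO_div h k (f : R -> QhV R d N) : (forall K j, epsO k (fun e => f e K 0 j)) ->
  forall K, epsO k (fun e => div_h h (f e) K : R).
Proof.
move=> H K.
apply: epsO_ext (epsOZ (@face_ratio R d h / 2) (epsO_sum (fun j =>
  epsOB (H (neighbor K (j, true)) j) (H (neighbor K (j, false)) j)))) => e.
by rewrite div_hE.
Qed.

Lemma epsO_visc h dt lambda k (f : R -> Qh R N) : (forall K, epsO k (fun e =>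
  f e K : R)) ->
  forall K, epsO k (fun e => visc h dt lambda (f e) K : R).
Proof.
move=> H K.
apply: epsO_ext (epsOB (H K) (epsOZ (dt * h * lambda) (epsOZ (@face_ratio R d h / h)
  (epsO_sum (fun s => epsOB (H (neighbor K s)) (H K)))))) => e.
by rewrite viscE lap_hE.
Qed.

End GridOrder.

(** * Asymptotics of one time step *)

Section LimitProducts.
Context {R : realType}.

Lemma epsO_lim (p : R -> R) a : epsO 1 (fun e => p e - a) -> epsO 0 p.
Proof.
move=> H; apply: epsO_ext (epsOD (epsO_weak (leq0n _) H) (epsO_cst a)) => e; ring.
Qed.

Lemma epsOM_lim (p q : R -> R) a b : epsO 1 (fun e => p e - a) -> epsO 1 (fun e =>
  q e - b) ->
  epsO 1 (fun e => p e * q e - a * b).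
Proof.
move=> Hp Hq.
apply: epsO_ext (epsOD (epsOM Hp (epsO_lim Hq)) (epsOZ a Hq)) => e; ring.
Qed.

Lemma epsOV_lim (p : R -> R) a : 0 < a -> epsO 1 (fun e => p e - a) ->
  epsO 1 (fun e => (p e)^-1 - a^-1).
Proof.
move=> a0 Hp; apply: (@epsO_eq _ _ _ (fun e => (- a^-1) * ((p e - a) * (p e)^-1))).
  have c2 : 0 < a / 2 by rewrite divr_gt0.
  apply: filterS (epsO_near_gt a0 Hp) => e /(lt_trans c2) pe.
  by field; rewrite !gt_eqF.
by apply: epsOZ; apply: (epsOM (k := 1) (l := 0)) => //; exact: epsO_inv a0 Hp.
Qed.

End LimitProducts.

Section OneStep.
Context {R : realType} {d : nat} {N : 'I_d -> nat}.
Implicit Types (K : cell N) (r phi x rho : Qh R N) (u m : QhV R d N).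

Lemma explicit_momentumE (h dt : R) r u K j : explicit_momentum h dt r u K 0 j =
  (r K : R) * u K 0 j - dt * div_h h [ffun L => \row_i (r L * u L 0 j * u L 0 i)] K.
Proof.
rewrite /explicit_momentum !gridE; congr (_ - dt * _).
rewrite ffunE mxE; congr (div_h h _ K).
by apply/ffunP => L; apply/rowP => i; rewrite !ffunE !mxE big_ord1 !mxE.
Qed.

Lemma explicit_momentum_cst (h dt rho0 : R) u :
  explicit_momentum h dt (cst_grid rho0) u = rho0 *: (u - dt *: divT_h h (tensor u u)).
Proof.
apply/ffunP => K; apply/rowP => j; rewrite explicit_momentumE ffunE.
have -> : [ffun L => \row_i ((cst_grid rho0 : Qh R N) L * u L 0 j * u L 0 i)] =
    rho0 *: ([ffun L => row j (tensor u u L)] : QhV R d N).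
  by apply/ffunP => L; apply/rowP => i; rewrite !ffunE !mxE big_ord1 !mxE mulrA.
rewrite divZ !gridE mulrBr mulrCA; congr (_ - _ * (_ * _)).
by rewrite [divT_h _ _ _]ffunE mxE.
Qed.

Lemma epsO_explicit_momentum (h dt rho0 : R) (r : R -> Qh R N) (u : R -> QhV R d N) u0 :
  (forall K, epsO 1 (fun e => (r e K : R) - rho0)) ->
  (forall K j, epsO 1 (fun e => u e K 0 j - u0 K 0 j)) ->
  forall K j, epsO 1 (fun e => (explicit_momentum h dt (r e) (u e)
     - explicit_momentum h dt (cst_grid rho0) u0) K 0 j).
Proof.
move=> Hr Hu K j.
have Hd : epsO 1 (fun e => div_h h ([ffun L => \row_i (r e L * u e L 0 j * u e L 0 i)]
   - [ffun L => \row_i ((cst_grid rho0 : Qh R N) L * u0 L 0 j * u0 L 0 i)]) K : R).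
  apply: epsO_div => L i.
  apply: epsO_ext (epsOM_lim (epsOM_lim (Hr L) (Hu L j)) (Hu L i)) => e.
  by rewrite !gridE !ffunE !mxE.
apply: epsO_ext (epsOB (epsOM_lim (Hr K) (Hu K j)) (epsOZ dt Hd)) => e.
rewrite gridVsubE.
apply: etrans (congr2 (fun p q => p - q) (explicit_momentumE h dt (r e) (u e) K j)
  (explicit_momentumE h dt (cst_grid rho0) u0 K j)) _.
rewrite divB gridDE gridNE cst_gridE.
by move: (div_h _ _ _) (div_h _ _ _) => X Y; ring.
Qed.

Variables (h dt lambda rho0 a : R).
Hypotheses (h_gt0 : 0 < h) (dt_gt0 : 0 < dt) (lambda_ge0 : 0 <= lambda)
  (rho0_gt0 : 0 < rho0) (a_gt0 : 0 < a).
Let k := dt ^+ 2 * a.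
Let k_gt0 : 0 < k. Proof. by rewrite mulr_gt0 // exprn_gt0. Qed.
Local Notation A := (visc h dt lambda).

(** A fixes constants, so the leading term rho_0 passes through. *)
Lemma visc_perturbation c phi : A (cst_grid rho0 + c *: phi) =
  cst_grid rho0 + c *: A phi.
Proof. by rewrite viscD viscZ visc_cst. Qed.

(** After application of A, the constant rho_0 cancels and a factor eps^2
    compensates the 1 / eps^2 in front of the pressure term. *)
Lemma step_perturbation e r r' u u' rho2 rho2' : 0 < e ->
  r = cst_grid rho0 + e ^+ 2 *: rho2 -> r' = cst_grid rho0 + e ^+ 2 *: rho2' ->
  scheme_step h dt lambda e a r u r' u' ->
  e ^+ 2 *: A (A rho2') - k *: div_h h (grad_h h rho2') =
  e ^+ 2 *: A rho2 - dt *: div_h h (explicit_momentum h dt r u).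
Proof.
move=> e0 rE r'E /(step_density h_gt0 dt_gt0 lambda_ge0 (ltW a_gt0)).
have -> : A r = cst_grid rho0 + e ^+ 2 *: A rho2 by rewrite rE visc_perturbation.
have -> : A (A r') = cst_grid rho0 + e ^+ 2 *: A (A rho2').
  by rewrite r'E !visc_perturbation.
have -> : grad_h h r' = e ^+ 2 *: grad_h h rho2'.
  by rewrite r'E gradD gradZ grad_cst add0r.
rewrite divZ (scalerA ((dt / e) ^+ 2 * a)).
have -> : (dt / e) ^+ 2 * a * e ^+ 2 = k by rewrite /k; field; rewrite gt_eqF.
move: (A (A rho2')) (A rho2) (div_h h _) (div_h h _) => P Q D0 D1 E.
by apply: (addrI (cst_grid rho0)); rewrite !addrA.
Qed.

(** Subtracting the limit potential x turns dt div_h m into the small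
    quantity dt div_h (m - m_0). *)
Lemma perturbation_energy e rho2 phi x m m0 : 0 < e ->
  k *: div_h h (grad_h h x) = dt *: div_h h m0 ->
  e ^+ 2 *: A (A phi) - k *: div_h h (grad_h h phi) =
    e ^+ 2 *: A rho2 - dt *: div_h h m ->
  e ^+ 2 * sdot (A (phi - x)) (A (phi - x))
    + k * vdot (grad_h h (phi - x)) (grad_h h (phi - x))
  <= e ^+ 2 * sdot (rho2 - A x) (rho2 - A x) + dt ^+ 2 / k * vdot (m - m0) (m - m0).
Proof.
move=> e0 xE phiE; apply: (density_energy dt_gt0 e0 k_gt0).
have -> : A (A (phi - x)) = A (A phi) - A (A x) by rewrite !viscB.
have -> : A (rho2 - A x) = A rho2 - A (A x) by rewrite viscB.
rewrite gradB !divB; move: xE phiE.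
move: (A (A phi)) (A (A x)) (A rho2) (div_h h (grad_h h phi)) => P X Q DP.
move: (div_h h (grad_h h x)) (div_h h m) (div_h h m0) => DX Dm Dm0 xE.
rewrite !scalerBr xE => /(canRL (subrK _)) ->.
rewrite !opprB (addrAC _ (k *: DP)) addrA (addrAC _ (dt *: Dm0)) addrK.
by rewrite (addrAC (e ^+ 2 *: Q)) -!addrA (addrC (dt *: Dm0)).
Qed.

Variables (r r' rho2 : R -> Qh R N) (u u' : R -> QhV R d N) (u0 : QhV R d N).
Hypotheses (r_near : \forall e \near 0^'+, r e = cst_grid rho0 + e ^+ 2 *: rho2 e)
  (rho2O : isO 0 rho2) (uO : isO 1 (fun e => u e - u0))
  (step : \forall e \near 0^'+, scheme_step h dt lambda e a (r e) (u e) (r' e) (u' e)).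

Let epsO_density (q : R -> Qh R N) (q2 : R -> Qh R N) :
  (\forall e \near 0^'+, q e = cst_grid rho0 + e ^+ 2 *: q2 e) -> isO 0 q2 ->
  forall K, epsO 1 (fun e => (q e K : R) - rho0).
Proof.
move=> qE /isO_epsO q2O K; apply: (@epsO_weak _ _ 2) => //.
apply: (@epsO_eq _ _ _ (fun e => e ^+ 2 * q2 e K));
  last exact: (epsOM (epsO_eps 2) (q2O K)).
by apply: filterS qE => e ->; rewrite !gridE addrC addKr.
Qed.

Let m e := explicit_momentum h dt (r e) (u e).
Let m0 := explicit_momentum h dt (cst_grid rho0) u0.

Let mO : forall K j, epsO 1 (fun e => (m e - m0) K 0 j).
Proof.
apply: epsO_explicit_momentum; first exact: epsO_density r_near rho2O.
by move=> K j; have /isO_epsOV/(_ K j) := uO; apply: epsO_ext => e; rewrite gridVsubE.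
Qed.

Variable rho2' : R -> Qh R N.
Hypothesis r'_near : \forall e \near 0^'+, r' e = cst_grid rho0 + e ^+ 2 *: rho2' e.

Section WithPotential.
Variable x : Qh R N.
Hypothesis xE : k *: div_h h (grad_h h x) = dt *: div_h h m0.

Let z e := rho2' e - x.
Let rhs e := e ^+ 2 * sdot (rho2 e - A x) (rho2 e - A x)
  + dt ^+ 2 / k * vdot (m e - m0) (m e - m0).

Let z_energy : \forall e \near 0^'+,
  e ^+ 2 * sdot (A (z e)) (A (z e)) + k * vdot (grad_h h (z e)) (grad_h h (z e)) <=
    rhs e.
Proof.
near=> e; have e0 : 0 < e by [].
have rE : r e = cst_grid rho0 + e ^+ 2 *: rho2 e by near: e.
have r'E : r' e = cst_grid rho0 + e ^+ 2 *: rho2' e by near: e.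
have stepE : scheme_step h dt lambda e a (r e) (u e) (r' e) (u' e) by near: e.
exact: (perturbation_energy e0 xE (step_perturbation e0 rE r'E stepE)).
Unshelve. all: end_near. Qed.

Let rhsO : epsO 2 rhs.
Proof.
have H : epsO 0 (fun e => sdot (rho2 e - A x) (rho2 e - A x)).
  apply/(epsO_sdot 0) => K; have /isO_epsO/(_ K) H := rho2O.
  by apply: epsO_ext (epsOB H (epsO_cst (A x K))) => e; rewrite gridDE gridNE.
apply: epsOD; first exact: (epsOM (epsO_eps 2) H).
by apply: epsOZ; apply/(epsO_vdot 1).
Qed.

Let zO K : epsO 0 (fun e => z e K : R).
Proof.
have [C C0 CP] := rhsO; move: K; apply/epsO_sdot; exists C => //; near=> e.
have e0 : 0 < e by [].
have e2 : 0 < e ^+ 2 by rewrite exprn_gt0.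
have H1 : e ^+ 2 * sdot (A (z e)) (A (z e)) + k * vdot (grad_h h (z e)) (grad_h h (z
  e)) <= rhs e by near: e.
have H2 : `|rhs e| <= C * e ^+ 2 by near: e.
have H3 : 0 <= k * vdot (grad_h h (z e)) (grad_h h (z e)).
  by rewrite mulr_ge0 ?vdot_ge0 // ltW.
rewrite mulr1 ger0_norm ?sdot_ge0 //.
apply: le_trans (visc_expand h_gt0 dt_gt0 lambda_ge0 _) _.
rewrite -(ler_pM2l e2) [leRHS]mulrC; have := ler_norm (rhs e); lra.
Unshelve. all: end_near. Qed.

Let grad_zO K j : epsO 1 (fun e => grad_h h (z e) K 0 j).
Proof.
move: K j; apply/epsO_vdot.
apply: epsO_le (epsOZ k^-1 rhsO); near=> e.
have e0 : 0 < e by [].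
have H1 : e ^+ 2 * sdot (A (z e)) (A (z e)) + k * vdot (grad_h h (z e)) (grad_h h (z
  e)) <= rhs e by near: e.
have H3 : 0 <= e ^+ 2 * sdot (A (z e)) (A (z e)).
  by rewrite mulr_ge0 ?sdot_ge0 // exprn_ge0 // ltW.
rewrite ger0_norm ?vdot_ge0 // (le_trans _ (ler_norm _)) // mulrC ler_pdivlMr // mulrC.
lra.
Unshelve. all: end_near. Qed.

Lemma next_rho2O : isO 0 rho2'.
Proof.
apply/isO_epsO => K; apply: epsO_ext (epsOD (zO K) (epsO_cst (x K))) => e.
by rewrite /z gridDE gridNE subrK.
Qed.

Let g := grad_h h x.

Lemma next_gradO K j : epsO 1 (fun e => grad_h h (rho2' e) K 0 j - g K 0 j).
Proof.
by apply: epsO_ext (grad_zO K j) => e; rewrite /z gradB gridVsubE.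
Qed.

Let w0 := visc_inv h dt lambda (m0 - (dt * a) *: g).
Let u0' := rho0^-1 *: w0.

Let momentumO K j : epsO 1 (fun e => (smul (r' e) (u' e) - w0) K 0 j).
Proof.
move: K j; apply/epsO_vdot.
have : epsO 2 (fun e => vdot (m e - m0 - (dt * a) *: (grad_h h (rho2' e) - g))
                      (m e - m0 - (dt * a) *: (grad_h h (rho2' e) - g))).
  apply/(epsO_vdot 1) => K j.
  apply: epsO_ext (epsOB (mO K j) (epsOZ (dt * a) (next_gradO K j))) => e.
  rewrite -gridVsubE; move: (m e - m0) (grad_h h _) => P Q.
  by rewrite gridVsubE gridVZE.
apply: epsO_le; near=> e; have e0 : 0 < e by [].
rewrite !ger0_norm ?vdot_ge0 //.
apply: le_trans (viscV_expand h_gt0 dt_gt0 lambda_ge0 _) _.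
suff -> : visc h dt lambda (smul (r' e) (u' e) - w0) =
  m e - m0 - (dt * a) *: (grad_h h (rho2' e) - g) by [].
rewrite viscB (visc_invK h_gt0 dt_gt0 lambda_ge0).
rewrite (@step_momentum _ _ _ _ _ _ h_gt0 dt_gt0 lambda_ge0 e a (r e) _ (u e));
  last by near: e.
have -> : r' e = cst_grid rho0 + e ^+ 2 *: rho2' e by near: e.
rewrite gradD grad_cst add0r gradZ scalerA -/(m e).
have -> : dt / e ^+ 2 * a * e ^+ 2 = dt * a by field; rewrite gt_eqF.
rewrite scalerBr; move: (m e) m0 (_ *: grad_h h _) (_ *: g) => P P0 Q S.
by rewrite !opprB !addrA [LHS]addrAC (addrAC P) [LHS]addrAC.
Unshelve. all: end_near. Qed.

Lemma next_uO : isO 1 (fun e => u' e - u0').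
Proof.
apply/isO_epsOV => K j.
have r'O := epsOV_lim rho0_gt0 (epsO_density r'_near next_rho2O K).
have wO : epsO 1 (fun e => smul (r' e) (u' e) K 0 j - w0 K 0 j).
  by apply: epsO_ext (momentumO K j) => e; rewrite gridVsubE.
apply: epsO_eq (epsOM_lim r'O wO).
have c2 : 0 < rho0 / 2 by rewrite divr_gt0.
apply: filterS (epsO_near_gt rho0_gt0 (epsO_density r'_near next_rho2O K)) => e.
move=> /(lt_trans c2) r'0; rewrite !gridE mulKf // gt_eqF //.
Qed.

(** In the mass balance rho and A rho' differ only by eps^2 times bounded
    perturbations, and so do rho' u' and rho_0 u'. *)
Lemma next_divO : isO 2 (fun e => div_h h (u' e)).
Proof.
apply/isO_epsO => K.
have H : epsO 0 (fun e => (dt * rho0)^-1 * (rho2 e K - A (rho2' e) K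
    - dt * div_h h (smul (rho2' e) (u' e)) K)).
  have /isO_epsO p2 := rho2O; have /isO_epsO p2' := next_rho2O;
    have /isO_epsOV pu := next_uO.
  apply: epsOZ; apply: epsOB.
    by apply: epsOB => //; apply: epsO_visc.
  apply: epsOZ; apply: epsO_div => L j.
  have ul : epsO 0 (fun e => u' e L 0 j).
    by apply: (@epsO_lim _ _ (u0' L 0 j)); apply: epsO_ext (pu L j) => e;
      rewrite !gridE.
  by apply: epsO_ext (epsOM (p2' L) ul) => e; rewrite gridE.
apply: epsO_eq (epsOM (epsO_eps 2) H); near=> e; have e0 : 0 < e by [].
have rE : r e = cst_grid rho0 + e ^+ 2 *: rho2 e by near: e.
have r'E : r' e = cst_grid rho0 + e ^+ 2 *: rho2' e by near: e.
have : visc h dt lambda (r' e) = r e - dt *: div_h h (smul (r' e) (u' e)).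
  have stepE : scheme_step h dt lambda e a (r e) (u e) (r' e) (u' e) by near: e.
  exact: (step_mass h_gt0 dt_gt0 lambda_ge0 (ltW a_gt0) stepE).
rewrite rE r'E visc_perturbation.
have -> : smul (cst_grid rho0 + e ^+ 2 *: rho2' e) (u' e) =
    rho0 *: u' e + e ^+ 2 *: smul (rho2' e) (u' e).
  by apply/ffunP => L; apply/rowP => j; rewrite !gridE; ring.
rewrite divD !divZ.
move: (div_h h (u' e)) (div_h h (smul _ _)) (A (rho2' e)) (rho2 e) => D D2 X Y.
move/ffunP/(_ K); rewrite !gridE.
move: (D K : R) (D2 K : R) (X K : R) (Y K : R) => {D D2 X Y} D D2 X Y E.
have -> : D = (dt * rho0)^-1 * (dt * (rho0 * D)) by field; rewrite !gt_eqF.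
by rewrite [RHS]mulrCA; congr (_ * _); lra.
Unshelve. all: end_near. Qed.

Lemma next_limit_update : u0' = limit_update h dt lambda a rho0 u0 u0' g.
Proof.
have : visc h dt lambda u0' = rho0^-1 *: (m0 - (dt * a) *: g).
  by rewrite /u0' viscZ (visc_invK h_gt0 dt_gt0 lambda_ge0).
rewrite /m0 explicit_momentum_cst /limit_update {1}/visc => /(canRL (subrK _)) {1}->.
congr (_ + _); move: (_ - dt *: divT_h h _) g => P S.
rewrite scalerBr !scalerA mulVf ?scale1r ?gt_eqF //.
by congr (_ - _ *: _); ring.
Qed.

End WithPotential.

(** The conclusions reproduce the hypotheses on the old time level, so that the
    step can be iterated. *)
Lemma step_asymptotics : exists (u0' g : QhV R d N),
  [/\ isO 0 rho2', isO 1 (fun e => u' e - u0'), isO 2 (fun e => div_h h (u' e)),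
      forall K j, epsO 1 (fun e => grad_h h (rho2' e) K 0 j - g K 0 j) &
      u0' = limit_update h dt lambda a rho0 u0 u0' g].
Proof.
(* The potential of the limit, determined up to the kernel of the gradient. *)
have [x xE] := helmholtz h ((dt / k) *: m0).
have {}xE : k *: div_h h (grad_h h x) = dt *: div_h h m0.
  by rewrite xE divZ scalerA mulrCA divff ?mulr1 // gt_eqF.
by eexists; eexists; split; [exact: next_rho2O xE|exact: next_uO xE|exact: next_divO
  xE|exact: next_gradO xE|exact: next_limit_update].
Qed.

End OneStep.

(** * Asymptotics of all time steps *)

Section AllSteps.
Context {R : realType}.

Lemma derive1_pressure_gt0 (kappa gamma rho0 : R) :
  0 < kappa -> 1 < gamma -> 0 < rho0 -> 0 < derive1 (pressure kappa gamma) rho0.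
Proof.
move=> k0 g1 r0.
have D : is_derive rho0 1 (kappa \*: (@powR R ^~ gamma)) (kappa *: (gamma * rho0 `^
  (gamma - 1))).
  by apply: is_deriveZ; exact: is_derive1_powR.
rewrite derive1E (_ : pressure kappa gamma = kappa \*: (@powR R ^~ gamma)) //.
rewrite derive_val mulr_gt0 // mulr_gt0 ?powR_gt0 //; lra.
Qed.

Lemma cvg_rV_epsO (n : nat) (f : R -> 'rV[R]_n) (v : 'rV[R]_n) :
  (forall j, epsO 1 (fun e => f e 0 j - v 0 j)) -> f e @[e --> 0^'+] --> v.
Proof.
move=> H; apply/cvgrPdist_le => eta eta0.
have : \forall e \near 0^'+, forall j, `|v 0 j - f e 0 j| <= eta.
  by apply: filter_forall => j; have /cvgrPdist_le := epsO_cvg (H j); exact.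
apply: filterS => e He; apply/rV_norm_le; first exact: ltW.
by move=> j; rewrite !mxE.
Qed.

Lemma asymptotics (d : nat) (N : 'I_d -> nat) (h : R) (M : nat) (dt : nat -> R)
    (a lambda rho0 : R) (rho : R -> nat -> Qh R N) (u : R -> nat -> QhV R d N)
    (rho2_init : R -> Qh R N) (u0_init : QhV R d N) :
  0 < h -> (forall n, (n < M)%N -> 0 < dt n) -> 0 < a -> 0 <= lambda -> 0 < rho0 ->
  (\forall eps \near 0^'+, rho eps 0%N = cst_grid rho0 + eps ^+ 2 *: rho2_init eps) ->
  isO 0 rho2_init -> isO 1 (fun eps => u eps 0%N - u0_init) ->
  (\forall eps \near 0^'+, forall n, (n < M)%N ->
     scheme_step h (dt n) lambda eps a
       (rho eps n) (u eps n) (rho eps n.+1) (u eps n.+1)) ->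
  exists (rho2 : R -> nat -> Qh R N) (u0 g : nat -> QhV R d N),
    [/\ u0 0%N = u0_init,
        forall n, (1 <= n <= M)%N ->
          [/\ \forall eps \near 0^'+,
                rho eps n = cst_grid rho0 + eps ^+ 2 *: rho2 eps n,
              isO 0 (fun eps => rho2 eps n),
              isO 1 (fun eps => u eps n - u0 n) &
              isO 2 (fun eps => div_h h (u eps n))] &
        forall n, (n < M)%N ->
          (forall K, grad_h h (rho2 eps n.+1) K @[eps --> 0^'+] --> g n.+1 K)
          /\
          u0 n.+1 = limit_update h (dt n) lambda a rho0
                      (u0 n) (u0 n.+1) (g n.+1)].
Proof.
move=> h0 dt0 a0 l0 r0 rho_init rho2O uO step.
pose rho2 e n : Qh R N := e ^- 2 *: (rho e n - cst_grid rho0).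
have rhoE n : \forall e \near 0^'+, rho e n = cst_grid rho0 + e ^+ 2 *: rho2 e n.
  apply: filterS right_gt0 => e e0.
  by rewrite /rho2 scalerA divff ?scale1r 1?addrC ?subrK // expf_neq0 // gt_eqF.
(* What a step needs and reproduces; v is the leading-order velocity, chosen
     step by step. *)
pose inv n v := isO 0 (fun e => rho2 e n) /\ isO 1 (fun e => u e n - v).
have ex (nv : nat * QhV R d N) : exists wg : QhV R d N * QhV R d N,
    (nv.1 < M)%N -> inv nv.1 nv.2 ->
    [/\ inv nv.1.+1 wg.1, isO 2 (fun e => div_h h (u e nv.1.+1)),
      (forall K, grad_h h (rho2 e nv.1.+1) K @[e --> 0^'+] --> wg.2 K) &
      wg.1 = limit_update h (dt nv.1) lambda a rho0 nv.2 wg.1 wg.2].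
  (* Outside the invariant, (v, v) is an arbitrary value, needed for choice only. *)
  case: nv => n v /=; have [nM|] := boolP (n < M)%N; last by exists (v, v).
  have [[rO vO]|Ninv] := pselect (inv n v); last by exists (v, v).
  have stepn : \forall e \near 0^'+, scheme_step h (dt n) lambda e a
      (rho e n) (u e n) (rho e n.+1) (u e n.+1).
    by apply: filterS step => e; apply.
  have [w [g [H1 H2 H3 H4 H5]]] := step_asymptotics h0 (dt0 n nM) l0 r0 a0 (rhoE n) rO
    vO stepn (rhoE n.+1).
  by exists (w, g) => _ _; split=> // K; apply: cvg_rV_epsO => j; exact: H4.
have [F FP] := choice ex.
pose u0 := fix u0 n := if n is n'.+1 then (F (n', u0 n')).1 else u0_init.
pose g n := if n is n'.+1 then (F (n', u0 n')).2 else 0.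
have invn n : (n <= M)%N -> inv n (u0 n).
  elim: n => [_|n IHn nM]; last by have [] := FP (n, u0 n) nM (IHn (ltnW nM)).
  split=> //; apply/isO_epsO => K; have /isO_epsO/(_ K) := rho2O; apply: epsO_eq.
  near=> e; have e0 : 0 < e by [].
  have rE : rho e 0%N = cst_grid rho0 + e ^+ 2 *: rho2_init e by near: e.
  rewrite /rho2 rE addrC addKr scalerA mulVf ?scale1r //.
  by rewrite expf_neq0 // gt_eqF.
exists rho2, u0, g; split=> // [[//|n] /= nM|n nM].
  have [H1 H2 H3 H4] := FP (n, u0 n) nM (invn n (ltnW nM)).
  by have [H5 H6] := H1; split.
by have [H1 H2 H3 H4] := FP (n, u0 n) nM (invn n (ltnW nM)).
Unshelve. all: end_near. Qed.

End AllSteps.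

(** * Mean values over cells *)

Section EpsilonDelta.
Context {R : realType} {V : normedModType R}.
Implicit Types (g : V -> R) (p q : V).

(** Continuity at a point in the form in which the mean values below use it. *)
Lemma cvg_eps_le g p : (forall e, 0 < e -> \forall q \near p, `|g p - g q| <= e) ->
  {for p, continuous g}.
Proof. exact: (@cvgrPdist_le _ _ _ (nbhs p) (nbhs_filter p) g _).2. Qed.

Lemma continuous_eps_delta g p e : {for p, continuous g} -> 0 < e ->
  exists2 r, 0 < r & forall q, `|q - p| < r -> `|g q - g p| <= e.
Proof.
move=> /(@cvgrPdist_le _ _ _ (nbhs p) (nbhs_filter p) g _).1 H e0.
have /nbhs_normP[r /= r0 Hr] := H e e0.
by exists r => // q qp; rewrite distrC; apply: Hr; rewrite /= distrC.
Qed.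

Lemma near_norm_lt p r : 0 < r -> \forall q \near p, `|q - p| < r.
Proof. by move=> r0; apply/nbhs_normP; exists r => // q /=; rewrite distrC. Qed.

Lemma continuous_translate g w : continuous g -> continuous (fun p => g (p + w)).
Proof.
move=> cg p; apply: cvg_eps_le => e e0.
have [r r0 gr] := continuous_eps_delta (cg (p + w)) e0.
apply: filterS (near_norm_lt p r0) => q qp.
by rewrite distrC; apply: gr; rewrite opprD addrACA subrr addr0.
Qed.

Lemma continuous_sub g f : continuous g -> continuous f -> continuous (fun p =>
  g p - f p).
Proof. by move=> cg cf p; apply: continuousB; [exact: cg|exact: cf]. Qed.

Lemma continuous_scale c g : continuous g -> continuous (fun p => c * g p).
Proof. by move=> cg p; apply: continuousM; [exact: cst_continuous|exact: cg]. Qed.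

End EpsilonDelta.

Section Means.
Context {R : realType} {d : nat}.
Implicit Types (g f : 'rV[R]_d -> R) (x y w : 'rV[R]_d) (i : 'I_d).
Variable (h : R).
Hypothesis h_gt0 : 0 < h.
Local Notation mu := (@lebesgue_measure R).

Lemma norm_delta_mx i : `|delta_mx 0 i : 'rV[R]_d| <= 1.
Proof.
rewrite [leLHS]mx_normrE; apply/bigmax_leP; split=> // -[j k] _ /=.
by rewrite mxE; case: (_ && _); rewrite ?normr1 ?normr0.
Qed.

Lemma norm_line s i : `|s *: delta_mx 0 i : 'rV[R]_d| <= `|s|.
Proof. by rewrite normrZ ler_piMr // norm_delta_mx. Qed.

Lemma line_continuous x i : continuous (fun s : R => x + s *: delta_mx 0 i : 'rV[R]_d).
Proof. by move=> s; apply: cvgD; [exact: cvg_cst|apply: cvgZr_tmp; exact: cvg_id]. Qed.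

Lemma integrable_line g x i : continuous g ->
  mu.-integrable `[0, h] (EFin \o (fun s : R => g (x + s *: delta_mx 0 i))).
Proof.
move=> cg; apply: continuous_compact_integrable; first exact: segment_compact.
apply: continuous_subspaceT => s; apply: continuous_comp; first exact: line_continuous.
exact: cg.
Qed.

Lemma line_meanB g f i x : continuous g -> continuous f ->
  line_mean h i (fun y => g y - f y) x = line_mean h i g x - line_mean h i f x.
Proof. by move=> cg cf; rewrite /line_mean RintegralB ?mulrBr //;
  exact: integrable_line. Qed.

Lemma line_meanZ c g i x : continuous g ->
  line_mean h i (fun y => c * g y) x = c * line_mean h i g x.
Proof. by move=> cg; rewrite /line_mean RintegralZl 1?mulrCA //;
  exact: integrable_line. Qed.

Lemma line_mean_cst c i x : line_mean h i (fun=> c) x = c.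
Proof.
rewrite /line_mean Rintegral_cst //= lebesgue_measure_itv /= lte_fin h_gt0 EFinN sube0
  /=.
by field; rewrite gt_eqF.
Qed.

Lemma line_mean_le g f i x : continuous g -> continuous f ->
  (forall s, 0 <= s <= h -> g (x + s *: delta_mx 0 i) <= f (x + s *: delta_mx 0 i)) ->
  line_mean h i g x <= line_mean h i f x.
Proof.
move=> cg cf gf; rewrite /line_mean ler_pM2l ?invr_gt0 //.
apply: le_Rintegral; [by []|exact: integrable_line|exact: integrable_line|].
by move=> s /=; rewrite in_itv /=; exact: gf.
Qed.

Lemma line_mean_close g c e i x : continuous g ->
  (forall s, 0 <= s <= h -> `|g (x + s *: delta_mx 0 i) - c| <= e) ->
  `|line_mean h i g x - c| <= e.
Proof.
move=> cg gc; rewrite ler_distl.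
have cst (z : R) : continuous (fun _ : 'rV[R]_d => z) by exact: cst_continuous.
apply/andP; split.
  rewrite -[leLHS](line_mean_cst _ i x); apply: line_mean_le => // s /gc.
  by rewrite ler_distl => /andP[].
rewrite -[leRHS](line_mean_cst _ i x); apply: line_mean_le => // s /gc.
by rewrite ler_distl => /andP[].
Qed.

Lemma line_mean_translate g w i :
  line_mean h i (fun y => g (y + w)) = (fun x => line_mean h i g (x + w)).
Proof.
apply/funext => x; rewrite /line_mean; congr (_ * _).
by apply: eq_Rintegral => s _; rewrite addrAC.
Qed.

(** The integrand is continuous jointly in the base point and the position on
    the segment, and the segment is compact, so near x the integrands are
    uniformly close. *)
Lemma line_mean_continuous g i : continuous g -> continuous (line_mean h i g).
Proof.
move=> cg x; apply: cvg_eps_le => eta eta0.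
have cpt : compact (`[0, h]%classic : set R) by exact: segment_compact.
have near_s s : `[0, h]%classic s -> \forall s' \near s & y \near nbhs x,
   `|g (y + s' *: delta_mx 0 i) - g (x + s' *: delta_mx 0 i)| <= eta.
  move=> _; have e2 : 0 < eta / 2 by rewrite divr_gt0.
  have [r r0 gr] := continuous_eps_delta (cg (x + s *: delta_mx 0 i)) e2.
  have r2 : 0 < r / 2 by rewrite divr_gt0.
  exists ([set s' | `|s' - s| < r / 2], [set y | `|y - x| < r / 2]).
    by split; [exact: (@near_norm_lt R R^o s _ r2)|exact: (@near_norm_lt R 'rV[R]_d x _
      r2)].
  move=> [s' y] /= [Hs Hy].
  have close z : `|z - x| < r / 2 ->
      `|g (z + s' *: delta_mx 0 i) - g (x + s *: delta_mx 0 i)| <= eta / 2.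
    move=> Hz; apply: gr; rewrite opprD addrACA -scalerBl.
    apply: le_lt_trans (ler_normD _ _) _; have := norm_line (s' - s) i; lra.
  have := close y Hy; have := close x; rewrite subrr normr0 => /(_ r2).
  rewrite !ler_norml; lra.
have : \forall y \near x, `[0, h]%classic `<=`
    (fun s => `|g (y + s *: delta_mx 0 i) - g (x + s *: delta_mx 0 i)| <= eta).
  by apply: (proj1 (compact_near_coveringP _) cpt 'rV[R]_d (nbhs x)
    (fun y s => `|g (y + s *: delta_mx 0 i) - g (x + s *: delta_mx 0 i)| <= eta)).
apply: filterS => y Hy.
have -> : line_mean h i g y = line_mean h i (fun z => g (z + (y - x))) x.
  by rewrite line_mean_translate addrC subrK.
rewrite distrC -line_meanB //; last exact: continuous_translate.
rewrite -[X in `|X|]subr0; apply: line_mean_close.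
  by apply: continuous_sub => //; exact: continuous_translate.
move=> s s01; rewrite subr0.
have := Hy s; rewrite /= in_itv /= => /(_ s01).
by rewrite [x + _ + (y - x)]addrAC addrCA subrr addr0.
Qed.

Definition seq_mean (s : seq 'I_d) g := foldr (line_mean h) g s.
Definition cell_mean g := seq_mean (enum 'I_d) g.

Lemma seq_mean_continuous s g : continuous g -> continuous (seq_mean s g).
Proof. by move=> cg; elim: s => //= i s IHs; exact: line_mean_continuous. Qed.

Lemma seq_meanB s g f x : continuous g -> continuous f ->
  seq_mean s (fun y => g y - f y) x = seq_mean s g x - seq_mean s f x.
Proof.
move=> cg cf; elim: s x => //= i s IHs x.
by rewrite -line_meanB; [congr (line_mean h i _ x);
  apply/funext|exact: seq_mean_continuous..].
Qed.

Lemma seq_meanZ c s g x : continuous g ->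
  seq_mean s (fun y => c * g y) x = c * seq_mean s g x.
Proof.
move=> cg; elim: s x => //= i s IHs x.
by rewrite -line_meanZ; [congr (line_mean h i _ x);
  apply/funext|exact: seq_mean_continuous].
Qed.

Lemma seq_mean_translate s g w :
  seq_mean s (fun y => g (y + w)) = (fun x => seq_mean s g (x + w)).
Proof. by elim: s => //= i s ->; rewrite line_mean_translate. Qed.

(** Every averaging direction moves the point by at most h; the distance is
    measured in the maximum norm, but bounding it by the number of directions
    avoids any reasoning on which coordinates have already moved. *)
Lemma seq_mean_close s g c e x : continuous g ->
  (forall y, `|y - x| <= h *+ size s -> `|g y - c| <= e) ->
  `|seq_mean s g x - c| <= e.
Proof.
move=> cg; elim: s x => /= [|i s IHs] x H; first by apply: H; rewrite subrr normr0.
apply: line_mean_close; first exact: seq_mean_continuous.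
move=> t /andP[t0 th]; apply: IHs => y Hy; apply: H.
have -> : y - x = (y - (x + t *: delta_mx 0 i)) + t *: delta_mx 0 i.
  by rewrite opprD addrA subrK.
rewrite mulrS addrC; apply: le_trans (ler_normD _ _) _; apply: lerD => //.
by apply: le_trans (norm_line _ _) _; rewrite ger0_norm.
Qed.

Lemma cell_mean_close g c e x : continuous g ->
  (forall y, `|y - x| <= h *+ d -> `|g y - c| <= e) ->
  `|cell_mean g x - c| <= e.
Proof. by move=> cg H; apply: seq_mean_close; rewrite // size_enum_ord. Qed.

End Means.

(** * Uniform continuity and mean values on the time slab *)

Section UniformContinuity.
Context {R : realType} {V : normedModType R}.
Variables (A K : set V) (F : V -> R).
Hypotheses (cF : {within A, continuous F}) (cK : compact K) (KA : K `<=` A).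

(** One of the two points ranges over the compact set only, the other over all
    of A; thus the neighboring points of the cells need not stay in the box. *)
Lemma heine_cantor e : 0 < e -> \forall r \near 0^'+, forall z z', K z -> A z' ->
  `|z' - z| < r -> `|F z' - F z| <= e.
Proof.
move=> e0; have e2 : 0 < e / 2 by rewrite divr_gt0.
have near_z z : K z -> \forall z1 \near z & r \near 0^'+,
    K z1 -> forall z', A z' -> `|z' - z1| < r -> `|F z' - F z1| <= e.
  move=> Kz; have := (subspace_continuousP _ _).1 cF z (KA Kz).
  move=> /(@cvgrPdist_le _ _ _ (within A (nbhs z)) _ F _).1 /(_ _ e2) H.
  have /nbhs_normP[r /= r0 Hr] := H.
  have r2 : 0 < r / 2 by rewrite divr_gt0.
  exists ([set z1 | `|z1 - z| < r / 2], [set s | s <= r / 2]).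
    by split; [exact: (near_norm_lt z r2)|exact: nbhs_right_le].
  move=> [z1 s] /= [z1z sr] Kz1 z' Az' z'z1.
  have H1 : `|F z - F z1| <= e / 2.
    by apply: Hr (KA Kz1); rewrite /= distrC; lra.
  have H2 : `|F z - F z'| <= e / 2.
    apply: Hr Az'; rewrite /= distrC -(subrK z1 z') -addrA.
    by apply: le_lt_trans (ler_normD _ _) _; lra.
  move: H1 H2; rewrite !ler_norml; lra.
have := (compact_near_coveringP _).1 cK.
move=> /near_covering_withinP /(_ R (0^'+) (fun r z1 => forall z', A z' ->
  `|z' - z1| < r -> `|F z' - F z1| <= e) _ near_z).
by apply: filterS => r H z z' Kz; apply: H.
Qed.

Lemma bounded_on_compact : \forall C \near +oo, forall z, K z -> `|F z| <= C.
Proof.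
have cFK : {within K, continuous F} by exact: (continuous_subspaceW KA cF).
have [M [Mr HM]] := @compact_bounded R R^o _ (continuous_compact cFK cK).
by exists M; split=> // C MC z Kz; apply: HM MC _ _; exists z.
Qed.

End UniformContinuity.

Section Slab.
Context {R : realType} {d : nat}.
Variables (T B : R).
Implicit Types (F : R * 'rV[R]_d -> R).

Definition slab_box : set (R * 'rV[R]_d) :=
  `[0, T]%classic `*` [set x : 'rV[R]_d | forall i, x 0 i \in `[- B, B]].

Lemma slab_box_compact : compact slab_box.
Proof.
apply: compact_setX; first exact: segment_compact.
apply: (@rV_compact _ d (fun=> `[- B, B]%classic)) => _; exact: segment_compact.
Qed.

Lemma slab_box_sub : slab_box `<=` slab T.
Proof. by move=> z []. Qed.

Lemma slab_uniform F (e : R) : {within slab T, continuous F} -> 0 < e ->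
  \forall r \near 0^'+, forall (s t : R) (x y : 'rV[R]_d), s \in `[0, T] ->
    t \in `[0, T] ->
    (forall i, `|x 0 i| <= B) -> `|s - t| < r -> `|y - x| < r ->
    `|F (s, y) - F (t, x)| <= e.
Proof.
move=> cF e0.
apply: filterS (heine_cantor cF slab_box_compact slab_box_sub e0) =>
  r H s t x y s0 t0 xB st yx.
apply: H => //; last by rewrite prod_normE gt_max st.
by split=> //= i; rewrite in_itv /= -ler_norml.
Qed.

Lemma slab_bounded F : {within slab T, continuous F} ->
  \forall C \near +oo, forall (t : R) (x : 'rV[R]_d), t \in `[0, T] ->
    (forall i, `|x 0 i| <= B) -> `|F (t, x)| <= C.
Proof.
move=> cF; apply: filterS (bounded_on_compact cF slab_box_compact slab_box_sub) =>
  C H t x t0 xB.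
by apply: H; split=> //= i; rewrite in_itv /= -ler_norml.
Qed.

Lemma slice_continuous F (t : R) : {within slab T, continuous F} -> t \in `[0, T] ->
  continuous (fun x : 'rV[R]_d => F (t, x)).
Proof.
move=> cF t0 x; apply: cvg_eps_le => e e0.
have := (subspace_continuousP _ _).1 cF (t, x) t0.
move=> /(@cvgrPdist_le _ _ _ (within (slab T) (nbhs (t, x))) _ F _).1 /(_ _ e0) H.
have /nbhs_normP[r /= r0 Hr] := H.
apply: filterS (near_norm_lt x r0) => y yx; apply: Hr => //=.
by rewrite prod_normE /= gt_max subrr normr0 r0 distrC.
Qed.

Lemma time_continuous F x (a b : R) : {within slab T, continuous F} -> 0 <= a -> b <=
  T ->
  {within `[a, b], continuous (fun t : R => F (t, x))}.
Proof.
move=> cF a0 bT; apply/subspace_continuousP => t tab.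
have t0 : t \in `[0, T] by move: tab; rewrite /= !in_itv /= => /andP[? ?];
  apply/andP; split; lra.
apply/(@cvgrPdist_le _ _ _ (within `[a, b]%classic (nbhs t)) _ _ _) => e e0.
have := (subspace_continuousP _ _).1 cF (t, x) t0.
move=> /(@cvgrPdist_le _ _ _ (within (slab T) (nbhs (t, x))) _ F _).1 /(_ _ e0) H.
have /nbhs_normP[r /= r0 Hr] := H.
apply: filterS (@near_norm_lt R R^o t r r0) => s st sab; apply: Hr => /=.
  by rewrite prod_normE /= gt_max subrr normr0 r0 distrC andbT.
by move: sab; rewrite /slab /= !in_itv /= => /andP[? ?]; apply/andP; split; lra.
Qed.

(** Along the line both difference quotients are literally the same function. *)
Lemma is_derive_line (f : 'rV[R]_d -> R) y i (s df : R) :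
  is_derive (y + s *: delta_mx 0 i) (delta_mx 0 i) f df ->
  is_derive s 1 (fun t : R => f (y + t *: delta_mx 0 i)) df.
Proof.
move=> [Hf <-].
have E : (fun k : R => k^-1 *: (f (y + (k *: (1 : R^o) + s) *: delta_mx 0 i) - f (y + s
  *: delta_mx 0 i)))
   = (fun k => k^-1 *: (f (k *: delta_mx 0 i + (y + s *: delta_mx 0 i)) - f (y + s *:
     delta_mx 0 i))).
  apply/funext => k; congr (_ *: (f _ - _)).
  by rewrite [_ *: 1]mulr1 scalerDl addrCA.
by split; [rewrite /derivable /= E|rewrite /derive /= E].
Qed.

Lemma mvt_line (f fi : 'rV[R]_d -> R) y i (h : R) : 0 < h ->
  (forall x, is_derive x (delta_mx 0 i) f (fi x)) ->
  exists2 s, 0 <= s <= h & f (y + h *: delta_mx 0 i) - f y =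
    fi (y + s *: delta_mx 0 i) * h.
Proof.
move=> h0 Hf.
have D (s : R) : is_derive s 1 (fun t : R => f (y + t *: delta_mx 0 i)) (fi (y + s *:
  delta_mx 0 i)).
  by apply: is_derive_line.
have [s] := @MVT R (fun t : R => f (y + t *: delta_mx 0 i)) (fun s =>
  fi (y + s *: delta_mx 0 i)) 0 h h0 (fun s _ => D s)
  (derivable_within_continuous (fun s _ => @ex_derive _ _ _ _ _ _ _ (D s))).
rewrite in_itv /= => /andP[s0 sh]; rewrite scale0r addr0 subr0 => E.
by exists s; rewrite // !ltW.
Qed.

End Slab.

(** * Projections of periodic functions and their difference quotients *)

Section Neighbors.
Context {R : realType} {d : nat}.
Variables (ell : 'I_d -> R) (N : 'I_d -> nat) (h : R).
Hypotheses (Nh : forall i, (N i)%:R * h = ell i).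
Implicit Types (K : cell N) (g : 'rV[R]_d -> R).

Definition corner K : 'rV[R]_d := \row_i ((K i)%:R * h).

Lemma proj_hE g K : proj_h N h g K = cell_mean h g (corner K).
Proof. by rewrite ffunE. Qed.

Lemma cell_mean_translate g x w :
  cell_mean h g (x + w) = cell_mean h (fun y => g (y + w)) x.
Proof. by rewrite /cell_mean seq_mean_translate. Qed.

Lemma cell_mean_periodic g x i : Defs.periodic ell g ->
  cell_mean h g (x + ell i *: delta_mx 0 i) = cell_mean h g x.
Proof.
move=> gP; rewrite cell_mean_translate.
by congr (cell_mean h _ x); apply/funext => y; rewrite gP.
Qed.

(** If the index wraps around, the corners differ by the period in direction i,
    which the mean value does not see. *)
Lemma proj_neighborS g K i : Defs.periodic ell g ->
  proj_h N h g (neighbor K (i, true)) = cell_mean h g (corner K + h *: delta_mx 0 i).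
Proof.
move=> gP; rewrite proj_hE.
have [KN|NK] := ltnP (K i).+1 (N i).
  congr (cell_mean h g _); apply/rowP => j; rewrite !mxE ffunE /=.
  case: eqP => [->|_]; last by rewrite mulr0 addr0.
  by rewrite /= modn_small // -natr1; ring.
rewrite -(cell_mean_periodic _ i gP).
congr (cell_mean h g _); apply/rowP => j; rewrite !mxE ffunE /=.
case: eqP => [->|_]; last by rewrite !mulr0.
have KN : (K i).+1 = N i by apply/eqP; rewrite eqn_leq NK andbT ltn_ord.
have NE : (N i)%:R = (K i)%:R + 1 :> R by rewrite natr1 KN.
by rewrite /= KN modnn -Nh NE; ring.
Qed.

Lemma proj_neighborP g K i : Defs.periodic ell g ->
  proj_h N h g (neighbor K (i, false)) = cell_mean h g (corner K - h *: delta_mx 0 i).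
Proof.
move=> gP; rewrite proj_hE.
have Ni : (0 < N i)%N by apply: leq_ltn_trans (ltn_ord (K i)).
have [K0|K0] := posnP (K i).
  rewrite -[RHS](cell_mean_periodic _ i gP).
  congr (cell_mean h g _); apply/rowP => j; rewrite !mxE ffunE /=.
  case: eqP => [->|_]; last by rewrite !mulr0 oppr0 !addr0.
  have NE : (N i)%:R = (N i).-1%:R + 1 :> R by rewrite natr1 prednK.
  by rewrite /= K0 add0n modn_small ?prednK // -Nh NE; ring.
congr (cell_mean h g _); apply/rowP => j; rewrite !mxE ffunE /=.
case: eqP => [->|_]; last by rewrite mulr0 oppr0 addr0.
rewrite /=; have -> : ((K i + N i).-1 %% N i)%N = (K i).-1.
  by rewrite -subn1 addnC -addnBA // subn1 modnDl modn_small // (leq_ltn_trans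
    (leq_pred _)).
have KE : (K i)%:R = (K i).-1%:R + 1 :> R by rewrite natr1 prednK.
by rewrite KE; ring.
Qed.

End Neighbors.

Section DifferenceQuotients.
Context {R : realType} {d : nat}.
Variables (h : R).
Hypothesis h_gt0 : 0 < h.

(** The quotient of the means is the mean of the quotients, and each of these
    is a value of the derivative at most h farther away. *)
Lemma cell_mean_quotient (f fi : 'rV[R]_d -> R) i x (c e : R) : continuous f ->
  (forall y, is_derive y (delta_mx 0 i) f (fi y)) ->
  (forall y, `|y - x| <= h *+ d.+1 -> `|fi y - c| <= e) ->
  `|h^-1 * (cell_mean h f (x + h *: delta_mx 0 i) - cell_mean h f x) - c| <= e.
Proof.
move=> cf Df Hc; rewrite cell_mean_translate /cell_mean.
have cft := continuous_translate (w := h *: delta_mx 0 i) cf.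
rewrite -seq_meanB // -seq_meanZ //; last exact: continuous_sub.
apply: cell_mean_close => //.
  exact: (continuous_scale (continuous_sub cft cf)).
move=> y yx; have [s /andP[s0 sh] ->] := mvt_line y h_gt0 Df.
rewrite mulrC mulfK ?gt_eqF //; apply: Hc.
rewrite addrAC mulrSr; apply: le_trans (ler_normD _ _) _; apply: lerD => //.
by apply: le_trans (norm_line _ _) _; rewrite ger0_norm.
Qed.

End DifferenceQuotients.

(** * Consistency of the individual difference operators *)

Section Components.
Context {R : realType} {d : nat} {N : 'I_d -> nat}.
Variable (h : R).
Hypothesis h_gt0 : 0 < h.

Lemma face_ratioE (j : 'I_d) : @face_ratio R d h = h^-1.
Proof.
case: d j => [[]//|n] _; rewrite /face_ratio /= exprS invfM mulrCA divff ?mulr1 //.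
by rewrite expf_neq0 // gt_eqF.
Qed.

Lemma divT_tensorE (U : QhV R d N) K j : divT_h h (tensor U U) K 0 j =
  \sum_i h^-1 / 2 * (U (neighbor K (i, true)) 0 j * U (neighbor K (i, true)) 0 i
                   - U (neighbor K (i, false)) 0 j * U (neighbor K (i, false)) 0 i).
Proof.
rewrite ffunE mxE div_hE (face_ratioE j) mulr_sumr; apply: eq_bigr => i _.
by rewrite !ffunE !mxE !big_ord1 !mxE.
Qed.

Lemma projVE (v : 'rV[R]_d -> 'rV[R]_d) K j :
  projV_h N h v K 0 j = proj_h N h (fun x => v x 0 j) K.
Proof. by rewrite ffunE mxE. Qed.

Lemma coord_projV (v : 'rV[R]_d -> 'rV[R]_d) j :
  coord j (projV_h N h v) = proj_h N h (fun x => v x 0 j).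
Proof. by apply/ffunP => K; rewrite coordE projVE. Qed.

Lemma limit_residualE (dt lambda a rho0 t : R) u r (K : cell N) j : 0 < dt ->
  limit_residual N h dt lambda a rho0 t u r K 0 j =
    dt^-1 * (proj_h N h (fun x => u (t + dt) x 0 j) K - proj_h N h (fun x =>
      u t x 0 j) K)
    + divT_h h (tensor (projV_h N h (u t)) (projV_h N h (u t))) K 0 j
    + a / rho0 * grad_h h (proj_h N h (r (t + dt))) K 0 j
    - lambda * (h * lap_h h (proj_h N h (fun x => u (t + dt) x 0 j)) K).
Proof.
move=> dt0; rewrite /limit_residual /limit_update.
rewrite -!coord_projV -coord_lap !coordE.
move: (projV_h N h (u (t + dt))) (projV_h N h (u t)) (grad_h h _) => U' U G.
move: (lap_h h U') (divT_h h _) => L D.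
rewrite gridVZE gridVsubE gridVDE 2!gridVsubE !gridVZE.
by move: (a / rho0) => b; field; rewrite gt_eqF.
Qed.

End Components.

Section LocalEstimates.
Context {R : realType} {d : nat}.
Variables (ell : 'I_d -> R) (N : 'I_d -> nat) (h : R).
Hypotheses (Nh : forall i, (N i)%:R * h = ell i) (h_gt0 : 0 < h).
Variables (K : cell N) (e : R).

(** Reaches every point that the stencil of K uses: d steps h within a mean
    value, one for the shift to a neighbor, one for the mean value theorem. *)
Definition around (y : 'rV[R]_d) := `|y - corner h K| <= h *+ d.+2.

(** On the stencil of K, f and its partial derivatives fd are within e of the
    constants b and c. *)
Definition close_data (f : 'rV[R]_d -> R) (fd : 'I_d -> 'rV[R]_d ->
  R) (b : R) (c : 'I_d -> R) :=
  [/\ Defs.periodic ell f, continuous f,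
      forall i y, is_derive y (delta_mx 0 i) f (fd i y),
      forall y, around y -> `|f y - b| <= e &
      forall i y, around y -> `|fd i y - c i| <= e].

Section OneFunction.
Variables (f : 'rV[R]_d -> R) (fd : 'I_d -> 'rV[R]_d -> R) (b : R) (c : 'I_d -> R).
Hypothesis fP : close_data f fd b c.
Local Notation P s := (proj_h N h f (neighbor K s) : R).
Local Notation P0 := (proj_h N h f K : R).

Lemma forward_quotient i : `|h^-1 * (P (i, true) - P0) - c i| <= e.
Proof.
have [per cf Df _ Hc] := fP; rewrite (proj_neighborS Nh) // proj_hE.
apply: (cell_mean_quotient h_gt0 cf (Df i)) => y yx; apply: Hc.
by apply: le_trans yx _; rewrite /around ler_pMn2l.
Qed.

Lemma around_shift i y n (s : R) : `|s| <= h -> (n < d.+2)%N ->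
  `|y - (corner h K + s *: delta_mx 0 i)| <= h *+ n -> around y.
Proof.
move=> sh nd yx; rewrite /around.
have -> : y - corner h K = (y - (corner h K + s *: delta_mx 0 i)) + s *: delta_mx 0 i.
  by rewrite opprD addrA subrK.
apply: le_trans (ler_normD _ _) _.
apply: le_trans (_ : h *+ n.+1 <= _); last by rewrite ler_pMn2l.
by rewrite mulrSr; apply: lerD => //; exact: le_trans (norm_line _ _) sh.
Qed.

Lemma backward_quotient i : `|h^-1 * (P0 - P (i, false)) - c i| <= e.
Proof.
have [per cf Df _ Hc] := fP; rewrite (proj_neighborP Nh) // proj_hE.
have -> : cell_mean h f (corner h K) =
    cell_mean h f (corner h K - h *: delta_mx 0 i + h *: delta_mx 0 i) by rewrite subrK.
apply: (cell_mean_quotient h_gt0 cf (Df i)) => y yx; apply: Hc.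
apply: (@around_shift i y d.+1 (- h)) => //; first by rewrite normrN gtr0_norm.
by rewrite scaleNr.
Qed.

Lemma centered_quotient i : `|h^-1 / 2 * (P (i, true) - P (i, false)) - c i| <= e.
Proof.
have := forward_quotient i; have := backward_quotient i; rewrite !ler_norml.
move: (P (i, true)) P0 (P (i, false)) (h^-1) => A B C k; lra.
Qed.

Lemma neighbor_value s : `|P s - b| <= e.
Proof.
have [per cf Df Hf _] := fP; case: s => i [].
  rewrite (proj_neighborS Nh) //; apply: (cell_mean_close h_gt0 cf) => y yx; apply: Hf.
  by apply: around_shift yx; rewrite ?gtr0_norm.
rewrite (proj_neighborP Nh) //; apply: (cell_mean_close h_gt0 cf) => y yx; apply: Hf.
by rewrite -scaleNr in yx; apply: around_shift yx; rewrite ?normrN ?gtr0_norm.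
Qed.

(** h Delta_h is the difference of the forward and backward quotients, which
    have the same limit. *)
Lemma lap_proj_small (j : 'I_d) : `|h * lap_h h (proj_h N h f) K| <= (2 * e) *+ d.
Proof.
have -> : h * lap_h h (proj_h N h f) K =
    \sum_i (h^-1 * (P (i, true) - P0) - h^-1 * (P0 - P (i, false))).
  rewrite lap_hE (face_ratioE h_gt0 j) sum_face !mulr_sumr; apply: eq_bigr => i _.
  by field; rewrite gt_eqF.
rewrite -[leRHS](_ : \sum_(i < d) 2 * e = _); last by rewrite sumr_const card_ord.
apply: le_trans (ler_norm_sum _ _ _) _; apply: ler_sum => i _.
have := forward_quotient i; have := backward_quotient i; rewrite !ler_norml.
move: (_ * _) (_ * _) => A B; lra.
Qed.

End OneFunction.

Lemma product_close (C p q b c : R) : e <= 1 -> 1 <= C -> `|b| <= C -> `|c| <= C ->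
  `|p - b| <= e -> `|q - c| <= e -> `|p * q - b * c| <= 3 * C * e.
Proof.
move=> e1 C1 bC cC pb qc.
have -> : p * q - b * c = (p - b) * (q - c) + (b * (q - c) + c * (p - b)) by ring.
have e0 : 0 <= e by apply: le_trans pb.
have H1 : `|(p - b) * (q - c)| <= C * e.
  by rewrite normrM; apply: ler_pM => //; apply: le_trans pb _; exact: le_trans C1.
have H2 : `|b * (q - c)| <= C * e by rewrite normrM; apply: ler_pM.
have H3 : `|c * (p - b)| <= C * e by rewrite normrM; apply: ler_pM.
apply: le_trans (ler_normD _ _) _.
have := ler_normD (b * (q - c)) (c * (p - b)); lra.
Qed.

(** Discrete product rule: A1 B1 - A0 B0 is half of
    (A1 + A0) (B1 - B0) + (B1 + B0) (A1 - A0). *)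
Lemma product_quotient (C : R) f fd b c g gd b' c' i :
  e <= 1 -> 1 <= C -> `|b| <= C -> `|c i| <= C -> `|b'| <= C -> `|c' i| <= C ->
  close_data f fd b c -> close_data g gd b' c' ->
  `|h^-1 / 2 * (proj_h N h f (neighbor K (i, true)) * proj_h N h g (neighbor K (i,
    true))
     - proj_h N h f (neighbor K (i, false)) * proj_h N h g (neighbor K (i, false)))
    - (b * c' i + b' * c i)| <= 6 * C * e.
Proof.
move=> e1 C1 bC cC b'C c'C fP gP.
have qf := centered_quotient fP i; have qg := centered_quotient gP i.
have f1 := neighbor_value fP (i, true); have f0 := neighbor_value fP (i, false).
have g1 := neighbor_value gP (i, true); have g0 := neighbor_value gP (i, false).
move: qf qg f1 f0 g1 g0.
move: (proj_h N h f (neighbor K (i, true)) : R) (proj_h N h f (neighbor K (i, false)) :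
  R).
move: (proj_h N h g (neighbor K (i, true)) : R) (proj_h N h g (neighbor K (i, false)) :
  R).
move=> B1 B0 A1 A0 qf qg f1 f0 g1 g0.
have mf : `|(A1 + A0) / 2 - b| <= e by move: f1 f0; rewrite !ler_norml; lra.
have mg : `|(B1 + B0) / 2 - b'| <= e by move: g1 g0; rewrite !ler_norml; lra.
have := product_close e1 C1 bC c'C mf qg.
have := product_close e1 C1 b'C cC mg qf.
have -> : h^-1 / 2 * (A1 * B1 - A0 * B0) - (b * c' i + b' * c i) =
  ((A1 + A0) / 2 * (h^-1 / 2 * (B1 - B0)) - b * c' i) +
  ((B1 + B0) / 2 * (h^-1 / 2 * (A1 - A0)) - b' * c i) by field; rewrite gt_eqF.
move=> H1 H2; apply: le_trans (ler_normD _ _) _; lra.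
Qed.

End LocalEstimates.

(** * Consistency of the limit update *)

Section Consistency.
Context {R : realType} {d : nat}.

Lemma sum_close (I : finType) (F G : I -> R) (e : R) :
  (forall i, `|F i - G i| <= e) -> `|\sum_i F i - \sum_i G i| <= e *+ #|I|.
Proof.
move=> H; rewrite -sumrB; apply: le_trans (ler_norm_sum _ _ _) _.
by rewrite -sumr_const; exact: ler_sum.
Qed.

Lemma limit_update_consistent (ell : 'I_d -> R) (T lambda a rho0 : R) :
  consistent_limit_update ell T lambda a rho0.
Proof.
move=> u r uper rper uC1 rC1 eqn eta eta0.
pose U j (z : R * 'rV[R]_d) := u z.1 z.2 0 j.
pose Q (z : R * 'rV[R]_d) := r z.1 z.2.
have cU j : {within slab T, continuous (U j)} by have [] := uC1 j.
have cQ : {within slab T, continuous Q} by have [] := rC1.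
have [ut utP] : {ut : 'I_d -> R * 'rV[R]_d -> R & forall j t x, t \in `]0, T[ ->
    is_derive t 1 (fun s => U j (s, x)) (ut j (t, x))}.
  apply: (@choice _ _ (fun j f => forall t x, t \in `]0, T[ ->
    is_derive t 1 (fun s => U j (s, x)) (f (t, x)))) => j.
  by have [_ [f [_ fP]] _] := uC1 j; exists f.
have [du duP] : {du : 'I_d * 'I_d -> R * 'rV[R]_d -> R & forall ji,
    {within slab T, continuous (du ji)} /\ forall t x, t \in `[0, T] ->
    is_derive x (delta_mx 0 ji.2) (fun y => U ji.1 (t, y)) (du ji (t, x))}.
  apply: (@choice _ _ (fun (ji : 'I_d * 'I_d) f => {within slab T, continuous f} /\
    forall t x, t \in `[0, T] ->
    is_derive x (delta_mx 0 ji.2) (fun y => U ji.1 (t, y)) (f (t, x)))) => -[j i].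
  by have [_ _ /(_ i)[f [cf fP]]] := uC1 j; exists f.
have [dr drP] : {dr : 'I_d -> R * 'rV[R]_d -> R & forall i,
    {within slab T, continuous (dr i)} /\ forall t x, t \in `[0, T] ->
    is_derive x (delta_mx 0 i) (fun y => Q (t, y)) (dr i (t, x))}.
  apply: (@choice _ _ (fun i f => {within slab T, continuous f} /\
    forall t x, t \in `[0, T] ->
    is_derive x (delta_mx 0 i) (fun y => Q (t, y)) (f (t, x)))) => i.
  by have [_ _ /(_ i)[f [cf fP]]] := rC1; exists f.
(* The equation gives the time derivative in terms of space derivatives. *)
have utE j t x : t \in `]0, T[ -> ut j (t, x) =
    - (\sum_i (U j (t, x) * du (i, i) (t, x) + U i (t, x) * du (j, i) (t, x))
       + a / rho0 * dr j (t, x)).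
  move=> t0; have tT : t \in `[0, T] by exact: subset_itv_oo_cc.
  have := eqn t x t0 j.
  have -> : derive1 (fun s => u s x 0 j) t = ut j (t, x).
    by rewrite derive1E; have Dt := utP j t x t0; exact: derive_val.
  have Dp i : 'D_(delta_mx 0 i) (fun y => u t y 0 j * u t y 0 i) x =
      U j (t, x) * du (i, i) (t, x) + U i (t, x) * du (j, i) (t, x).
    have D1 := (duP (i, i)).2 t x tT; have D2 := (duP (j, i)).2 t x tT.
    exact: (@derive_val _ _ _ _ _ _ _ (is_deriveM D2 D1)).
  rewrite (eq_bigr _ (fun i _ => Dp i)).
  have -> : 'D_(delta_mx 0 j) (fun y => a * r t y) x = a * dr j (t, x).
    have D1 := (drP j).2 t x tT.
    exact: (@derive_val _ _ _ _ _ _ _ (is_deriveZ a D1)).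
  by rewrite mulrAC => /eqP; rewrite -addrA addr_eq0 => /eqP.
(* A box that contains the corners of all the cells of every mesh. *)
pose B := \sum_i `|ell i|.
have [C [C1 CU CD]] : exists C, [/\ 1 <= C,
    forall j (t : R) (x : 'rV[R]_d), t \in `[0, T] -> (forall i, `|x 0 i| <= B) ->
      `|U j (t, x)| <= C &
    forall ji (t : R) (x : 'rV[R]_d), t \in `[0, T] -> (forall i, `|x 0 i| <= B) ->
      `|du ji (t, x)| <= C].
  have H1 : \forall C \near +oo, (1 : R) <= C by apply: nbhs_pinfty_ge; exact: num_real.
  have H2 : \forall C \near +oo, forall j (t : R) (x : 'rV[R]_d), t \in `[0, T] ->
      (forall i, `|x 0 i| <= B) -> `|U j (t, x)| <= C.
    by apply: filter_forall => j; exact: slab_bounded.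
  have H3 : \forall C \near +oo, forall ji (t : R) (x : 'rV[R]_d), t \in `[0, T] ->
      (forall i, `|x 0 i| <= B) -> `|du ji (t, x)| <= C.
    by apply: filter_forall => ji; exact: slab_bounded (duP ji).1.
  by have [C [[? ?] ?]] := filter_ex (filterI (filterI H1 H2) H3); exists C.
(* The residual will be bounded by W e. *)
pose W := (6 * C) *+ d *+ 2 + `|a / rho0| *+ 2 + `|lambda| * (2 *+ d).
have W0 : 0 <= W.
  by rewrite !addr_ge0 ?mulr_ge0 ?mulrn_wge0 ?normr_ge0 // mulr_ge0 //; lra.
pose e := Num.min 1 (eta / 2 / (W + 1)).
have W1 : 0 < W + 1 by rewrite ltr_wpDl.
have e0 : 0 < e by rewrite lt_min ltr01 !divr_gt0.
have e1 : e <= 1 by rewrite ge_min lexx.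
have eW : W * e <= eta / 2.
  have : e <= eta / 2 / (W + 1) by rewrite ge_min lexx orbT.
  by rewrite ler_pdivlMr // => H; nra.
pose unif (F : R * 'rV[R]_d -> R) (s : R) := forall (t' t : R) (x y : 'rV[R]_d), t' \in
  `[0, T] -> t \in `[0, T] ->
    (forall i, `|x 0 i| <= B) -> `|t' - t| < s -> `|y - x| < s ->
    `|F (t', y) - F (t, x)| <= e.
have [s [s0 sU sD sQ sR]] : exists s, [/\ 0 < s, forall j, unif (U j) s,
    forall ji, unif (du ji) s, unif Q s & forall j, unif (dr j) s].
  have H1 : \forall s \near 0^'+, forall j, unif (U j) s.
    by apply: filter_forall => j; exact: slab_uniform.
  have H2 : \forall s \near 0^'+, forall ji, unif (du ji) s.
    by apply: filter_forall => ji; apply: slab_uniform => //; exact: (duP ji).1.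
  have H3 : \forall s \near 0^'+, forall j, unif (dr j) s.
    by apply: filter_forall => j; apply: slab_uniform => //; exact: (drP j).1.
  have H4 : \forall s \near 0^'+, unif Q s by exact: slab_uniform.
  have [s [[[[? ?] ?] ?] ?]] :=
    filter_ex (filterI (filterI (filterI (filterI (@right_gt0 R) H1) H2) H4) H3).
  by exists s.
(* This makes the stencil radius (d + 2) h smaller than s. *)
exists (s / d.+3%:R); first by rewrite divr_gt0.
move=> N h dt t N1 Nh /andP[h0 hs] /andP[dt0 dts] t0 tT K.
have {hs} hs : h *+ d.+2 < s.
  move: hs; rewrite ltr_pdivlMr // mulr_natr => H; apply: le_lt_trans H.
  by rewrite ler_pMn2l.
have {}dts : dt < s.
  apply: lt_le_trans dts _; rewrite ler_pdivrMr //.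
  by apply: ler_peMr; [exact: ltW|rewrite ler1n].
pose x := corner h K.
have xB i : `|x 0 i| <= B.
  rewrite mxE ger0_norm; last by rewrite mulr_ge0 // ltW.
  apply: (@le_trans _ _ (ell i)).
    by rewrite -Nh ler_pM2r // ler_nat ltnW.
  apply: le_trans (ler_norm _) _; rewrite /B (bigD1 i) //= lerDl.
  by apply: sumr_ge0.
have tI : t \in `[0, T] by rewrite in_itv /= t0; lra.
have tI' : t + dt \in `[0, T] by rewrite in_itv /=; apply/andP; split; lra.
have tt : `|t - t| < s by rewrite subrr normr0.
have tt' : `|t + dt - t| < s by rewrite addrC addKr gtr0_norm.
have aroundP y : around h K y -> `|y - x| < s by move=> yx; exact: le_lt_trans hs.
have dataU t' j : t' \in `[0, T] -> `|t' - t| < s ->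
  close_data ell h K e (fun y => U j (t', y)) (fun i y => du (j, i) (t', y))
    (U j (t, x)) (fun i => du (j, i) (t, x)).
  move=> tI1 tt1; split.
  - by move=> i y; rewrite /U /= uper.
  - exact: slice_continuous.
  - by move=> i y; exact: (duP (j, i)).2.
  - by move=> y /aroundP yx; exact: sU.
  - by move=> i y /aroundP yx; exact: sD.
apply: le_lt_trans (_ : W * e < eta); last by apply: le_lt_trans eW _; lra.
apply/rV_norm_le; first by rewrite mulr_ge0 // ltW.
move=> j; rewrite limit_residualE //.
set E := (6 * C * e) *+ d + `|a / rho0| * e.
pose S := \sum_i (U j (t, x) * du (i, i) (t, x) + U i (t, x) * du (j, i) (t, x)).
(* Up to sign, this is the time derivative as given by the equation. *)
have Gclose tau y : tau \in `[0, T] -> `|tau - t| < s -> `|y - x| < s ->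
  `|\sum_i (U j (tau, y) * du (i, i) (tau, y) + U i (tau, y) * du (j, i) (tau, y))
     + a / rho0 * dr j (tau, y) - (S + a / rho0 * dr j (t, x))| <= E.
  move=> tauI taut yx; rewrite opprD addrACA -mulrBr.
  apply: le_trans (ler_normD _ _) _; apply: lerD.
    rewrite -[X in _ <= _ *+ X](card_ord d); apply: sum_close => i.
    rewrite opprD addrACA; apply: le_trans (ler_normD _ _) _.
    have P1 := product_close e1 C1 (CU j t x tI xB) (CD (i, i) t x tI xB)
      (sU j tau t x y tauI tI xB taut yx) (sD (i, i) tau t x y tauI tI xB taut yx).
    have P2 := product_close e1 C1 (CU i t x tI xB) (CD (j, i) t x tI xB)
      (sU i tau t x y tauI tI xB taut yx) (sD (j, i) tau t x y tauI tI xB taut yx).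
    by move: P1 P2; lra.
  by rewrite normrM; apply: ler_wpM2l => //; exact: sR.
have time : `|dt^-1 * (proj_h N h (fun x => u (t + dt) x 0 j) K - proj_h N h (fun x =>
  u t x 0 j) K)
    - (- (S + a / rho0 * dr j (t, x)))| <= E.
  rewrite !proj_hE /cell_mean.
  have c1 : continuous (fun x => u (t + dt) x 0 j) by exact: (slice_continuous (cU j)
    tI').
  have c0 : continuous (fun x => u t x 0 j) by exact: (slice_continuous (cU j) tI).
  rewrite -seq_meanB // -seq_meanZ //; last exact: continuous_sub.
  apply: cell_mean_close => //; first exact: (continuous_scale (continuous_sub c1 c0)).
  move=> y yx.
  have yx' : `|y - x| < s.
    by apply: aroundP; apply: le_trans yx _; rewrite ler_pMn2l // ltnW.
  have ltdt : t < t + dt by rewrite ltrDl.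
  have inT tau : tau \in `]t, t + dt[ -> tau \in `]0, T[.
    by rewrite !in_itv /= => /andP[? ?]; apply/andP; split; lra.
  (* The mean value theorem in time, for each point of the cell separately. *)
  have [tau taut] := MVT ltdt (fun tau H => utP j tau y (inT tau H)) (time_continuous
    (x := y) (cU j) t0 tT).
  rewrite /U /= => ->; rewrite [t + dt]addrC addrK mulrC mulfK ?gt_eqF //.
  have tauI := inT tau taut.
  have tauI' : tau \in `[0, T] by exact: subset_itv_oo_cc.
  have taus : `|tau - t| < s.
    by move: taut; rewrite in_itv /= ltr_norml => /andP[? ?]; apply/andP; split; lra.
  rewrite utE // -opprD normrN; exact: Gclose.
have div : `|divT_h h (tensor (projV_h N h (u t)) (projV_h N h (u t))) K 0 j - S| <=
  (6 * C * e) *+ d.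
  rewrite (divT_tensorE h0) -[X in _ <= _ *+ X](card_ord d); apply: sum_close => i.
  rewrite !projVE.
  exact: (product_quotient Nh h0 e1 C1 (CU j t x tI xB) (CD (j, i) t x tI xB)
    (CU i t x tI xB) (CD (i, i) t x tI xB) (dataU t j tI tt) (dataU t i tI tt)).
have dataR : close_data ell h K e (fun y => Q (t + dt, y)) (fun i y => dr i (t + dt, y))
    (Q (t, x)) (fun i => dr i (t, x)).
  split.
  - by move=> i y; rewrite /Q /= rper.
  - exact: slice_continuous.
  - by move=> i y; exact: (drP i).2.
  - by move=> y /aroundP yx; exact: sQ.
  - by move=> i y /aroundP yx; exact: sR.
have grad : `|grad_h h (proj_h N h (r (t + dt))) K 0 j - dr j (t, x)| <= e.
  rewrite grad_hE (face_ratioE h0 j); exact: (centered_quotient Nh h0 dataR j).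
have lap : `|h * lap_h h (proj_h N h (fun x => u (t + dt) x 0 j)) K| <= (2 * e) *+ d.
  exact: (lap_proj_small Nh h0 (dataU (t + dt) j tI' tt') j).
have gradW : `|a / rho0 * grad_h h (proj_h N h (r (t + dt))) K 0 j - a / rho0 * dr j
  (t, x)| <= `|a / rho0| * e.
  by rewrite -mulrBr normrM; exact: ler_wpM2l.
have lapW : `|lambda * (h * lap_h h (proj_h N h (fun x => u (t + dt) x 0 j)) K)| <=
  `|lambda| * ((2 * e) *+ d).
  by rewrite normrM; exact: ler_wpM2l.
have -> : W * e = E + (6 * C * e) *+ d + `|a / rho0| * e + `|lambda| * ((2 * e) *+ d).
  by rewrite /W /E; ring.
move: time div gradW lapW; rewrite !ler_norml.
move: (dt^-1 * _) (divT_h h _ K 0 j) (_ * grad_h h _ K 0 j) (lambda * _) => X1 X2 X3 X4.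
lra.
Qed.

End Consistency.

Theorem theorem3p3 (R : realType) (d : nat) (ell : 'I_d -> R)
    (N : 'I_d -> nat) (h : R) (T : R) (M : nat) (t : nat -> R)
    (kappa gamma lambda rho0 : R)
    (rho : R -> nat -> Qh R N) (u : R -> nat -> QhV R d N)
    (rho2_init : R -> Qh R N) (u0_init : QhV R d N) :
  let a := derive1 (pressure kappa gamma) rho0 in
  let dt n := t n.+1 - t n in
  (1 <= d <= 3)%N ->
  0 < h -> (forall i, 1 < N i)%N -> (forall i, (N i)%:R * h = ell i) ->
  t 0%N = 0 -> (forall n, (n < M)%N -> t n < t n.+1) -> t M = T ->
  0 < kappa -> 1 < gamma -> 0 <= lambda -> 0 < rho0 ->
  (\forall eps \near 0^'+,
     rho eps 0%N = cst_grid rho0 + eps ^+ 2 *: rho2_init eps) ->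
  isO 0 rho2_init ->
  isO 1 (fun eps => u eps 0%N - u0_init) ->
  (\forall eps \near 0^'+, forall n, (n < M)%N ->
     scheme_step h (dt n) lambda eps a
       (rho eps n) (u eps n) (rho eps n.+1) (u eps n.+1)) ->
  (exists (rho2 : R -> nat -> Qh R N) (u0 g : nat -> QhV R d N),
    [/\ u0 0%N = u0_init,
        forall n, (1 <= n <= M)%N ->
          [/\ \forall eps \near 0^'+,
                rho eps n = cst_grid rho0 + eps ^+ 2 *: rho2 eps n,
              isO 0 (fun eps => rho2 eps n),
              isO 1 (fun eps => u eps n - u0 n) &
              isO 2 (fun eps => div_h h (u eps n))] &
        forall n, (n < M)%N ->
          (forall K, grad_h h (rho2 eps n.+1) K @[eps --> 0^'+] --> g n.+1 K)
          /\
          u0 n.+1 = limit_update h (dt n) lambda a rho0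
                      (u0 n) (u0 n.+1) (g n.+1)])
  /\ consistent_limit_update ell T lambda a rho0.
Proof.
move=> a dt _ h0 _ _ _ tlt _ kappa0 gamma1 lambda0 rho00 rho_init rho2O uO step.
split; last exact: limit_update_consistent.
apply: (asymptotics h0 _ _ lambda0 rho00 rho_init rho2O uO step).
  by move=> n nM; rewrite subr_gt0; exact: tlt.
exact: derive1_pressure_gt0.
Qed.
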